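(* Consider the trivial quantum principal $U(1)$-bundle over the (non-commutative) Moyal--Weyl algebra $B$ with $(\theta^{\mu\nu})\neq0$, with the Euclidean metric on $\Omega^\bullet(B)$ and the two-dimensional quantum dual Lie algebra ${}_{\mathrm{inv}}\Gamma$ with basis $\{\vartheta^e,\vartheta^m\}$ described in the context. There are instantons that are not solutions of the non-commutative Yang--Mills equation $$(d^\star-d^{S^\omega\star})F^\omega(\vartheta^e)=(d^\star-d^{S^\omega\star})F^\omega(\vartheta^m)=0.$$ Here an instanton is a non-commutative gauge potential, i.e. a linear map $A^\omega:{}_{\mathrm{inv}}\Gamma\to\Omega^1(B)$, for which $\star F^\omega=-F^\omega$. Since $\{\vartheta^e,\vartheta^m\}$ is a basis of ${}_{\mathrm{inv}}\Gamma$, $A^\omega$ is an instanton if and only if $\star F^\omega(\vartheta^e)=-F^\omega(\vartheta^e)$ and $\star F^\omega(\vartheta^m)=-F^\omega(\vartheta^m)$; equivalently, $\mathbf D^e=\mathbf H^e$ and $\mathbf D^m=\mathbf H^m$.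
   Context: Base space. $(\theta^{\mu\nu})$ is an antisymmetric real $4\times4$ matrix whose entries are treated as formal central parameters fixed by complex conjugation (some entries may be set to zero, but not all). $B=C^\infty_{\mathbb C}(\mathbb R^4)[[\theta^{\mu\nu}]]$ is the space of formal power series in $\theta^{\mu\nu}$ with coefficients in complex-valued smooth functions of $(x^0,x^1,x^2,x^3)$, with the Moyal product $f\cdot h=m\circ\exp\left(\frac{i\theta^{\mu\nu}}{2}\frac{\partial}{\partial x^\mu}\otimes\frac{\partial}{\partial x^\nu}\right)(f\otimes h)$ ($m$ the pointwise product, $i=\sqrt{-1}$) and $*$ = complex conjugation. $\Omega^\bullet(B)=\Omega^\bullet_{\mathbb C}(\mathbb R^4)[[\theta^{\mu\nu}]]$ with the usual $d$ and product $(f\,dx^I)\wedge(h\,dx^J)=(f\cdot h)\,dx^I\wedge dx^J$. Euclidean structure. $\langle f\,dx^I,h\,dx^J\rangle=f\cdot h^*\,\delta^{IJ}$ for increasing multi-indices $I,J$; $\mathrm{dvol}=dx^0\wedge dx^1\wedge dx^2\wedge dx^3$; $\langle\hat\mu|\mu\rangle=\int_B\langle\hat\mu,\mu\rangle\,\mathrm{dvol}$ (usual integral on $\mathbb R^4$, coefficientwise in $\theta^{\mu\nu}$). $\star:\Omega^k(B)\to\Omega^{4-k}(B)$ is the antilinear Hodge operator, $\star(f\,dx^I)=f^*\cdot\star dx^I$, with $\hat\mu\cdot(\star\mu)=\langle\hat\mu,\mu\rangle\,\mathrm{dvol}$; in particular $\star(dx^0\wedge dx^1)=dx^2\wedge dx^3$,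 $\star(dx^0\wedge dx^2)=-dx^1\wedge dx^3$, $\star(dx^0\wedge dx^3)=dx^1\wedge dx^2$, $\star(dx^1\wedge dx^2)=dx^0\wedge dx^3$, $\star(dx^1\wedge dx^3)=-dx^0\wedge dx^2$, $\star(dx^2\wedge dx^3)=dx^0\wedge dx^1$, and $\star^2=(-1)^{k(4-k)}\mathrm{id}$. $d^\star:=(-1)^{k+1}\star^{-1}\circ d\circ\star:\Omega^{k+1}(B)\to\Omega^k(B)$. Structure group calculus. $H=\mathbb C[z,z^{-1}]$ (functions on $U(1)$), with counit $\epsilon(z^n)=1$; the bundle has total space $P=B\otimes H$. For $q\in\mathbb R\setminus\{0,1,-1\}$ let $\hat{\mathcal L}=\mathrm{span}_{\mathbb C}\{\theta_-,\theta_+\}$ be the dual of $\mathrm{span}_{\mathbb C}\{z,z^{-1}\}$, with $\theta_-(z)=1$, $\theta_-(z^{-1})=0$, $\theta_+(z)=0$, $\theta_+(z^{-1})=1$, and let $\varpi:\mathrm{Ker}(\epsilon)\to\hat{\mathcal L}$, $\varpi(g)(x)=\mathcal Q(g\otimes x)$, $\mathcal Q(z^m\otimes z^n)=q^{2mn}$. The $*$-first order differential calculus on $H$ is the bicovariant one with ${}_{\mathrm{inv}}\Gamma=\mathrm{Ker}(\epsilon)/\mathrm{Ker}(\varpi)\cong\hat{\mathcal L}$, which is two-dimensional with basis $\vartheta^e:=-i\theta_-$, $\vartheta^m:=-i\theta_+$; in its universal differential envelope $d\vartheta^e=d\vartheta^m=i(\vartheta^e\vartheta^m+\vartheta^m\vartheta^e)$.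 The embedded differential used is $\Theta:{}_{\mathrm{inv}}\Gamma\to{}_{\mathrm{inv}}\Gamma\otimes{}_{\mathrm{inv}}\Gamma$, $\Theta(\vartheta^e)=\Theta(\vartheta^m)=i(\vartheta^e\otimes\vartheta^m+\vartheta^m\otimes\vartheta^e)$. Fields. The field strength of $A^\omega:{}_{\mathrm{inv}}\Gamma\to\Omega^1(B)$ is $F^\omega:=dA^\omega-m\circ(A^\omega\otimes A^\omega)\circ\Theta$ ($m$ the product of $\Omega^\bullet(B)$), i.e. for $a\in\{e,m\}$ $$F^\omega(\vartheta^a)=dA^\omega(\vartheta^a)-i\,A^\omega(\vartheta^e)\wedge A^\omega(\vartheta^m)-i\,A^\omega(\vartheta^m)\wedge A^\omega(\vartheta^e).$$ Write $F^\omega(\vartheta^a)=\sum_{0\le\mu<\nu\le3}F^a_{\mu\nu}\,dx^\mu\wedge dx^\nu$. The triples $\mathbf D^e,\mathbf H^e,\mathbf D^m,\mathbf H^m\in B^3$ are defined by $F^e_{0j}=D^e_j$, $F^e_{12}=-H^e_3$, $F^e_{13}=H^e_2$, $F^e_{23}=-H^e_1$, and $F^m_{0j}=H^m_j$, $F^m_{12}=-D^m_3$, $F^m_{13}=D^m_2$, $F^m_{23}=-D^m_1$ ($j=1,2,3$). Yang--Mills operator. For $\alpha\in\Omega^1(B)$, $\beta\in\Omega^l(B)$ put $[\alpha,\beta]^\partial:=\alpha\wedge\beta-(-1)^l\beta\wedge\alpha$. For linear $T:{}_{\mathrm{inv}}\Gamma\to\Omega^k(B)$, $d^{S^\omega}T(\vartheta^e)=d^{S^\omega}T(\vartheta^m):=i[A^\omega(\vartheta^e),T(\vartheta^m)]^\partial+i[A^\omega(\vartheta^m),T(\vartheta^e)]^\partial$.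 $d^{S^\omega\star}$ is its formal adjoint with respect to $\langle T|T'\rangle=\langle T(\vartheta^e)|T'(\vartheta^e)\rangle+\langle T(\vartheta^m)|T'(\vartheta^m)\rangle$; explicitly, for linear $T:{}_{\mathrm{inv}}\Gamma\to\Omega^{k+1}(B)$, $$d^{S^\omega\star}T(\vartheta^e)=(-1)^k\,i\,\star^{-1}\left([A^\omega(\vartheta^m),\star(T(\vartheta^e)+T(\vartheta^m))]^\partial\right),$$ $$d^{S^\omega\star}T(\vartheta^m)=(-1)^k\,i\,\star^{-1}\left([A^\omega(\vartheta^e),\star(T(\vartheta^e)+T(\vartheta^m))]^\partial\right).$$
   Formalization: Since the Hodge star is antilinear, the equivalence with D^e=H^e, D^m=H^m fails for complex potentials; it is replaced by H^e=(D^e)^*, D^m=(H^m)^* in general, and by D=H when the field strength is self-conjugate. *)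

(* Defs.v *)
From HB Require Import structures.
From mathcomp Require Import all_boot all_order all_algebra.
From mathcomp Require Import ring.
From mathcomp Require Import complex finmap generic_quotient ring_quotient.
From mathcomp Require Import mathcomp_extra boolp classical_sets functions cardinality fsbigop reals topology normedtype derive.
Set Implicit Arguments.
Unset Strict Implicit.
Unset Printing Implicit Defensive.
Import Order.TTheory GRing.Theory Num.Theory.
Import numFieldNormedType.Exports.
Local Open Scope ring_scope.
Local Open Scope complex_scope.

Section Smooth.
Variable R : realType.
Notation E := 'rV[R]_4.

Definition axis (mu : 'I_4) : E := delta_mx 0 mu.

(* Class C^n, by recursion on n: f is continuous, its four partial derivatives
   exist everywhere, and they are of class C^(n-1). *)
Fixpoint Cn (n : nat) (f : E -> R) : Prop :=
  match n with
  | 0 => continuous f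
  | m.+1 => continuous f /\ forall mu : 'I_4,
      (forall x, derivable f x (axis mu)) /\ Cn m ('D_(axis mu) f)
  end.

Definition smooth_real (f : E -> R) := forall n, Cn n f.

Definition smooth : {pred E -> R[i]} := fun f =>
  `[< smooth_real (fun x => complex.Re (f x)) /\ smooth_real (fun x => complex.Im (f x)) >].

Lemma smooth_realP f : smooth_real f <->
  continuous f /\ forall mu, (forall x, derivable f x (axis mu)) /\ smooth_real ('D_(axis mu) f).
Proof.
split=> [sf|[cf sf] [|n]//=].
  split=> [|mu]; first exact: (sf 0).
  split=> [|n]; first by case: (sf 1) => _ /(_ mu)[].
  by case: (sf n.+1) => _ /(_ mu)[].
by split=> // mu; have [? /(_ n)] := sf mu.
Qed.

Lemma Cn_cst n c : Cn n (fun=> c).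
Proof.
elim: n c => [|n IH] c /=; first exact: cst_continuous.
split; first exact: cst_continuous.
move=> mu; split=> [x|]; first exact: derivable_cst.
rewrite (_ : 'D_(axis mu) _ = fun=> 0) //.
by apply/funext => x; rewrite derive_cst.
Qed.

Lemma CnD n f g : Cn n f -> Cn n g -> Cn n (fun x => f x + g x).
Proof.
elim: n f g => [|n IH] f g /= => [cf cg x|[cf df] [cg dg]]; first exact: cvgD (cf x) (cg x).
split=> [x|mu]; first exact: cvgD (cf x) (cg x).
have [[dfm Cf] [dgm Cg]] := (df mu, dg mu); split=> [x|]; first exact: derivableD.
rewrite (_ : 'D_(axis mu) _ = fun x => 'D_(axis mu) f x + 'D_(axis mu) g x); first exact: IH.
by apply/funext => x; exact: deriveD.
Qed.

Lemma CnS n f : Cn n.+1 f -> Cn n f.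
Proof.
elim: n f => [|n IH] f; first by case.
by case=> cf df; split=> // mu; have [? ?] := df mu; split=> //; exact: IH.
Qed.

Lemma CnM n f g : Cn n f -> Cn n g -> Cn n (fun x => f x * g x).
Proof.
elim: n f g => [|n IH] f g => [cf cg x|Hf Hg]; first exact: cvgM (cf x) (cg x).
case: (Hf) (Hg) => [cf df] [cg dg].
split=> [x|mu]; first exact: cvgM (cf x) (cg x).
have [[dfm Cf] [dgm Cg]] := (df mu, dg mu); split=> [x|]; first exact: derivableM.
rewrite (_ : 'D_(axis mu) _ = fun x => f x * 'D_(axis mu) g x + g x * 'D_(axis mu) f x).
  by apply: CnD; apply: IH => //; exact: CnS.
by apply/funext => x; exact: deriveM.
Qed.

Lemma smooth_real_cst c : smooth_real (fun=> c).
Proof. by move=> n; exact: Cn_cst. Qed.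
Lemma smooth_realD f g : smooth_real f -> smooth_real g -> smooth_real (fun x => f x + g x).
Proof. by move=> sf sg n; exact: CnD. Qed.
Lemma smooth_realM f g : smooth_real f -> smooth_real g -> smooth_real (fun x => f x * g x).
Proof. by move=> sf sg n; exact: CnM. Qed.
Lemma smooth_realN f : smooth_real f -> smooth_real (fun x => - f x).
Proof.
move=> sf; rewrite (_ : (fun _ => _) = fun x => -1 * f x).
  by apply: smooth_realM => //; exact: smooth_real_cst.
by apply/funext => x; rewrite mulN1r.
Qed.

Lemma smoothP f : reflect
  (smooth_real (fun x => complex.Re (f x)) /\ smooth_real (fun x => complex.Im (f x)))
  (f \in smooth).
Proof. exact: asboolP. Qed.

Lemma smooth_cst c : (fun=> c) \in smooth.
Proof. by apply/smoothP; split; exact: smooth_real_cst. Qed.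

Lemma ReM (x y : R[i]) : complex.Re (x * y) = complex.Re x * complex.Re y - complex.Im x * complex.Im y.
Proof. by case: x y => [a b] [c d]. Qed.
Lemma ImM (x y : R[i]) : complex.Im (x * y) = complex.Re x * complex.Im y + complex.Im x * complex.Re y.
Proof. by case: x y => [a b] [c d]. Qed.

Lemma smoothD f g : f \in smooth -> g \in smooth -> f + g \in smooth.
Proof.
move=> /smoothP[fr fi] /smoothP[gr gi]; apply/smoothP; split.
  rewrite (_ : (fun _ => _) = fun x => complex.Re (f x) + complex.Re (g x)).
    exact: smooth_realD.
  by apply/funext => x; rewrite addrfctE raddfD.
rewrite (_ : (fun _ => _) = fun x => complex.Im (f x) + complex.Im (g x)).
  exact: smooth_realD.
by apply/funext => x; rewrite addrfctE raddfD.
Qed.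

Lemma smoothM f g : f \in smooth -> g \in smooth -> f * g \in smooth.
Proof.
move=> /smoothP[fr fi] /smoothP[gr gi]; apply/smoothP; split.
  under eq_fun do rewrite mulrfctE ReM.
  by apply: smooth_realD; [|apply: smooth_realN]; exact: smooth_realM.
under eq_fun do rewrite mulrfctE ImM.
by apply: smooth_realD; exact: smooth_realM.
Qed.

Lemma smooth_subring : subring_closed smooth.
Proof.
split=> [|f g sf sg|]; [exact: smooth_cst| |exact: smoothM].
apply: smoothD => //; rewrite -mulN1r; apply: smoothM => //.
exact: (smooth_cst (-1)).
Qed.

Lemma smooth_submod : submod_closed smooth.
Proof.
split=> [|c f g sf sg]; first exact: (smooth_cst 0).
by apply: smoothD => //; exact: (smoothM (smooth_cst c)).
Qed.

HB.instance Definition _ := GRing.isSubringClosed.Build (E -> R[i]) smooth smooth_subring.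
HB.instance Definition _ := GRing.isSubmodClosed.Build R[i] (E -> R[i]) smooth smooth_submod.

(* C^oo(R^4, C) with its pointwise operations *)
Record smooth_fun := SmoothFun {smooth_val :> E -> R[i]; _ : smooth_val \in smooth}.
HB.instance Definition _ := [isSub for smooth_val].
HB.instance Definition _ := [Choice of smooth_fun by <:].
HB.instance Definition _ := [SubChoice_isSubComNzRing of smooth_fun by <:].
HB.instance Definition _ := [SubZmodule_isSubLmodule of smooth_fun by <:].

Definition pd_fun mu (f : E -> R[i]) : E -> R[i] := fun x =>
  Complex ('D_(axis mu) (fun y => complex.Re (f y)) x) ('D_(axis mu) (fun y => complex.Im (f y)) x).
Lemma pd_smooth mu (f : smooth_fun) : pd_fun mu f \in smooth.
Proof.
have /smoothP[/smooth_realP[_ /(_ mu)[_ sr]] /smooth_realP[_ /(_ mu)[_ si]]] := valP f.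
by apply/smoothP; split.
Qed.
Definition pd mu f := SmoothFun (pd_smooth mu f).
Lemma sconj_smooth (f : smooth_fun) : (fun x => conjc (f x)) \in smooth.
Proof.
have /smoothP[fr fi] := valP f; apply/smoothP; split.
  rewrite (_ : (fun _ => _) = fun x => complex.Re (f x)) //.
  by apply/funext => x; case: (f x).
rewrite (_ : (fun _ => _) = fun x => - complex.Im (f x)).
  exact: smooth_realN.
by apply/funext => x; case: (f x).
Qed.
Definition sconj f := SmoothFun (sconj_smooth f).
End Smooth.

Section Moyal.
Variables (R : realType) (S : {set 'I_4 * 'I_4}).
Notation K := R[i].

(* S is the set of pairs (mu, nu), mu < nu, for which theta^{mu nu} has not been
   set to 0; there is one formal parameter for each of its elements. *)
Definition param := {p : 'I_4 * 'I_4 | p \in S}.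

Definition mon := {ffun param -> nat}.
Definition mdeg (a : mon) : nat := \sum_p a p.

(* C^oo(R^4, C)[[theta]]: f a is the coefficient of the monomial theta^a.
   A function type also inherits a pointwise product from its codomain; it is
   never used here, the product of the algebra is moyal below. *)
Definition moyal_alg := mon -> smooth_fun R.
HB.instance Definition _ := GRing.Lmodule.on moyal_alg.

(* theta^{mu nu} is the formal parameter p when (mu, nu) = p, and its opposite
   when (nu, mu) = p. *)
Definition is_letter (p : param) (l : 'I_4 * 'I_4) : bool :=
  (l == val p) || (l == ((val p).2, (val p).1)).

(* coefficient of theta^a in the product of the theta^{mu nu} over the (mu, nu)
   listed in w, theta being antisymmetric and supported by S *)
Definition theta_coef (w : seq ('I_4 * 'I_4)) (a : mon) : K :=
  if all (fun l => [exists p : param, is_letter p l]) w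
     && [forall p : param, count (is_letter p) w == a p]
  then (-1) ^+ count (fun l : 'I_4 * 'I_4 => (l.2 < l.1)%N) w
  else 0.

Definition pds (s : seq 'I_4) (f : smooth_fun R) : smooth_fun R :=
  foldr (@pd R) f s.

(* coefficient of theta^a in
     m (exp (i/2 theta^{mu nu} d_mu (x) d_nu) (f (x) g));
   only the term of order n = |a| of the exponential contributes:
     (i/2)^n / n! sum_{mu_k, nu_k} (prod_k theta^{mu_k nu_k})
       (d_{mu_1} .. d_{mu_n} f) (d_{nu_1} .. d_{nu_n} g) *)
Definition moyal_coef (a : mon) (f g : smooth_fun R) : smooth_fun R :=
  (('i%C / 2) ^+ mdeg a / (mdeg a)`!%:R) *:
    \sum_(w : (mdeg a).-tuple ('I_4 * 'I_4))
      theta_coef w a *: (pds [seq l.1 | l <- w] f * pds [seq l.2 | l <- w] g).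

Definition mon_le (a : mon) := {ffun param -> 'I_(mdeg a).+1}.
Definition mon_of (a : mon) (b : mon_le a) : mon := [ffun p => b p : nat].

(* extension to formal power series: the coefficient of theta^a collects the
   triples of monomials with theta^b theta^c theta^e = theta^a *)
Definition moyal (f g : moyal_alg) : moyal_alg := fun a =>
  \sum_(t : mon_le a * mon_le a * mon_le a
        | [forall p, (t.1.1 p + t.1.2 p + t.2 p)%N == a p])
     moyal_coef (mon_of t.2) (f (mon_of t.1.1)) (g (mon_of t.1.2)).

Definition mconj (f : moyal_alg) : moyal_alg := fun a => sconj (f a).
Definition mpd (mu : 'I_4) (f : moyal_alg) : moyal_alg := fun a => pd mu (f a).

(* Omega^*(B): a I is the coefficient of dx^I, where the set I stands for the
   increasing multi-index listing its elements *)
Definition exterior := {set 'I_4} -> moyal_alg.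
HB.instance Definition _ := GRing.Lmodule.on exterior.

(* dx^I /\ dx^J = ext_sign I J dx^(I u J) for disjoint I and J *)
Definition ext_sign (I J : {set 'I_4}) : K :=
  (-1) ^+ #|[set p : 'I_4 * 'I_4 | [&& p.1 \in I, p.2 \in J & (p.2 < p.1)%N]]|.

Definition wedge (a b : exterior) : exterior := fun J =>
  \sum_(I : {set 'I_4} | I \subset J)
     ext_sign I (J :\: I) *: moyal (a I) (b (J :\: I)).

Definition dext (a : exterior) : exterior := fun J =>
  \sum_(mu in J) ext_sign [set mu] (J :\ mu) *: mpd mu (a (J :\ mu)).

(* star (f dx^I) = f^* star dx^I, with star dx^I = ext_sign I (~: I) dx^(~: I),
   i.e. dx^I /\ star dx^I = dvol *)
Definition star (a : exterior) : exterior := fun J =>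
  ext_sign (~: J) J *: mconj (a (~: J)).
Definition starinv (a : exterior) : exterior := fun I =>
  ext_sign I (~: I) *: mconj (a (~: I)).

Lemma conj_sign n : conjc ((-1) ^+ n : K) = (-1) ^+ n.
Proof. by rewrite rmorphXn rmorphN1. Qed.

Lemma mconj_signZ n f : mconj ((-1) ^+ n *: f) = (-1) ^+ n *: mconj f.
Proof.
apply/funext => a; apply/val_inj/funext => x /=.
exact: (etrans (rmorphM _ _ _) (congr1 (fun z => z * _) (conj_sign n))).
Qed.

Lemma mconjK : involutive mconj.
Proof.
by move=> f; apply/funext => a; apply/val_inj/funext => x /=; rewrite conjcK.
Qed.

Lemma starK : cancel star starinv.
Proof.
move=> a; apply/funext => I; rewrite /starinv /star finset.setCK mconj_signZ mconjK.
by rewrite scalerA -expr2 sqrr_sign scale1r.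
Qed.

Lemma starinvK : cancel starinv star.
Proof.
move=> a; apply/funext => I; rewrite /starinv /star finset.setCK mconj_signZ mconjK.
by rewrite scalerA -expr2 sqrr_sign scale1r.
Qed.

(* d^star on forms of degree k.+1 *)
Definition codiff (k : nat) (a : exterior) : exterior :=
  (-1) ^+ k.+1 *: starinv (dext (star a)).

(* [a, b]^partial for a of degree 1 and b of degree l *)
Definition gcomm (l : nat) (a b : exterior) : exterior :=
  wedge a b - (-1) ^+ l *: wedge b a.

Definition homog k : {pred exterior} :=
  fun a => `[< forall I : {set 'I_4}, #|I| <> k -> a I = 0 >].

Lemma homog_submod k : submod_closed (homog k).
Proof.
split=> [|c a b /asboolP Ha /asboolP Hb]; apply/asboolP => I Ik //.
by rewrite addrfctE scalrfctE Ha // Hb // scaler0 addr0.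
Qed.

HB.instance Definition _ k :=
  GRing.isSubmodClosed.Build K exterior (homog k) (homog_submod k).

(* Omega^k(B) *)
Record Omega k := MkOmega {Omega_val :> exterior; _ : Omega_val \in homog k}.
HB.instance Definition _ k := [isSub for @Omega_val k].
HB.instance Definition _ k := [Choice of Omega k by <:].
HB.instance Definition _ k := [SubChoice_isSubLmodule of Omega k by <:].

End Moyal.

Section StructureGroup.
Variable R : realType.
Notation K := R[i].

Definition laurent_pred : {pred int -> K} :=
  fun g => `[< exists A : {fset int}, forall n, n \notin A -> g n = 0 >].

Lemma laurent_submod : submod_closed laurent_pred.
Proof.
split=> [|c f g /asboolP[A HA] /asboolP[B HB]]; apply/asboolP.
  by exists fset0.
exists (A `|` B)%fset => n; rewrite in_fsetU negb_or => /andP[nA nB].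
by rewrite addrfctE scalrfctE HA // HB // scaler0 addr0.
Qed.

HB.instance Definition _ :=
  GRing.isSubmodClosed.Build K (int -> K) laurent_pred laurent_submod.

(* H = C[z, z^-1] as a vector space: g n is the coefficient of z^n *)
Record laurent := Laurent {laurent_val :> int -> K; _ : laurent_val \in laurent_pred}.
HB.instance Definition _ := [isSub for laurent_val].
HB.instance Definition _ := [Choice of laurent by <:].
HB.instance Definition _ := [SubChoice_isSubLmodule of laurent by <:].

Lemma zpow_subproof (n : int) : (fun m : int => (m == n)%:R) \in laurent_pred.
Proof.
apply/asboolP; exists [fset n]%fset => m.
by rewrite in_fset1 => /negbTE ->.
Qed.
Definition zpow n : laurent := Laurent (zpow_subproof n).

Definition counit (g : laurent) : K := \sum_(n \in [set: int]) g n.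

Definition pairing (q : R) (g h : laurent) : K :=
  \sum_(m \in [set: int]) \sum_(n \in [set: int])
     g m * h n * (q ^ (2 * m * n))%:C.

(* The dual of span{z, z^-1}; an element is recorded by its values at z and at
   z^-1, so that theta_- and theta_+ are the two standard basis vectors. *)
Definition Lhat := 'rV[K]_2.
Definition theta_m : Lhat := delta_mx 0 0.
Definition theta_p : Lhat := delta_mx 0 1.

Definition varpi (q : R) (g : laurent) : Lhat :=
  \row_(j < 2) pairing q g (zpow (if j == 0 then 1 else -1)).

Lemma laurentP (f g : laurent) : exists A : {fset int},
  forall n, n \notin A -> f n = 0 /\ g n = 0.
Proof.
have [/asboolP[A HA] /asboolP[B HB]] := (valP f, valP g).
exists (A `|` B)%fset => n; rewrite in_fsetU negb_or => /andP[nA nB].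
by split; [exact: HA|exact: HB].
Qed.

Lemma laurentE (c : K) (f g : laurent) n : (c *: f + g) n = c * f n + g n.
Proof. by []. Qed.

Lemma wsum_linear (w : int -> K) (c : K) (f g : laurent) :
  \sum_(n \in [set: int]) (c *: f + g) n * w n =
  c * (\sum_(n \in [set: int]) f n * w n) + \sum_(n \in [set: int]) g n * w n.
Proof.
have [A HA] := laurentP f g.
have [fA gA] : (forall n, n \notin A -> f n * w n = 0) /\
    (forall n, n \notin A -> g n * w n = 0).
  by split=> n /HA[fn gn]; rewrite ?fn ?gn mul0r.
rewrite (@fsbigTE _ _ _ _ A (fun n => f n * w n) fA).
rewrite (@fsbigTE _ _ _ _ A (fun n => g n * w n) gA).
rewrite (@fsbigTE _ _ _ _ A) => [|n nA]; last first.
  by rewrite laurentE mulrDl -mulrA fA // gA // mulr0 addr0.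
rewrite big_distrr /= -big_split; apply: eq_bigr => n _.
by rewrite -/(f n) -/(g n) mulrA -[RHS]mulrDl.
Qed.

Lemma counit_linear : linear_for *%R counit.
Proof.
move=> c f g; have E h : counit h = \sum_(n \in [set: int]) h n * 1.
  by apply: eq_fsbigr => n _; rewrite mulr1.
rewrite !E; exact: wsum_linear.
Qed.
HB.instance Definition _ := GRing.isLinear.Build K laurent K *%R counit counit_linear.

Lemma pairing_zpow q g n :
  pairing q g (zpow n) = \sum_(m \in [set: int]) g m * (q ^ (2 * m * n))%:C.
Proof.
apply: eq_fsbigr => m _.
rewrite (@fsbigTE _ _ _ _ [fset n]%fset) => [|k].
  by rewrite big_seq_fset1 /= eqxx mulr1.
by rewrite in_fset1 /= => /negbTE ->; rewrite mulr0 mul0r.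
Qed.

Lemma varpi_linear q : linear (varpi q).
Proof.
move=> c f g; apply/rowP => j; rewrite !mxE !pairing_zpow; exact: wsum_linear.
Qed.
HB.instance Definition _ q := GRing.isLinear.Build K laurent Lhat *:%R (varpi q) (varpi_linear q).

Definition ker_counit_pred : {pred laurent} := fun g => counit g == 0.
Lemma ker_counit_submod : submod_closed ker_counit_pred.
Proof.
split=> [|c f g /eqP Hf /eqP Hg]; rewrite /in_mem /= /ker_counit_pred.
  by rewrite linear0.
by rewrite linearP /= Hf Hg mulr0 addr0.
Qed.
HB.instance Definition _ :=
  GRing.isSubmodClosed.Build K laurent ker_counit_pred ker_counit_submod.
Record ker_counit := KerCounit {ker_val :> laurent; _ : ker_val \in ker_counit_pred}.
HB.instance Definition _ := [isSub for ker_val].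
HB.instance Definition _ := [Choice of ker_counit by <:].
HB.instance Definition _ := [SubChoice_isSubLmodule of ker_counit by <:].

Section InvGamma.
Variable q : R.

Definition ker_varpi_pred : {pred ker_counit} := fun g => varpi q g == 0.
Lemma ker_varpi_zmod : zmod_closed ker_varpi_pred.
Proof.
split=> [|f g /eqP Hf /eqP Hg]; rewrite /in_mem /= /ker_varpi_pred.
  by rewrite linear0.
by rewrite linearB /= Hf Hg subr0.
Qed.
HB.instance Definition _ :=
  GRing.isZmodClosed.Build ker_counit ker_varpi_pred ker_varpi_zmod.

(* Ker(counit) / Ker(varpi) *)
Definition inv_Gamma := Quotient.quot ker_varpi_pred.
HB.instance Definition _ := GRing.Zmodule.on inv_Gamma.
HB.instance Definition _ := EqQuotient.on inv_Gamma.

Definition inv_pi (g : ker_counit) : inv_Gamma := (\pi_inv_Gamma g)%qT.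

Lemma inv_piP (f g : ker_counit) : inv_pi f = inv_pi g <-> varpi q f = varpi q g.
Proof.
split=> [/eqP|E].
  by rewrite -Quotient.idealrBE => /eqP; rewrite linearB => /eqP; rewrite subr_eq0 => /eqP.
by apply/eqP; rewrite -Quotient.idealrBE; apply/eqP; rewrite linearB /= E subrr.
Qed.

Lemma inv_piD f g : inv_pi (f + g) = inv_pi f + inv_pi g.
Proof. exact: raddfD. Qed.

Lemma inv_piK x : inv_pi (repr x) = x.
Proof. exact: reprK. Qed.

Lemma inv_repr g : varpi q (repr (inv_pi g)) = varpi q g.
Proof. by apply/inv_piP; rewrite inv_piK. Qed.

Definition inv_scale (c : K) (x : inv_Gamma) : inv_Gamma := inv_pi (c *: repr x).

Lemma inv_piZ c g : inv_scale c (inv_pi g) = inv_pi (c *: g).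
Proof. by apply/inv_piP; rewrite !linearZ /= inv_repr. Qed.

Lemma inv_scaleA c d x : inv_scale c (inv_scale d x) = inv_scale (c * d) x.
Proof. by rewrite -(inv_piK x) !inv_piZ scalerA. Qed.
Lemma inv_scale1 : left_id 1 inv_scale.
Proof. by move=> x; rewrite -(inv_piK x) inv_piZ scale1r. Qed.
Lemma inv_scaleDr : right_distributive inv_scale +%R.
Proof.
by move=> c x y; rewrite -(inv_piK x) -(inv_piK y) -inv_piD !inv_piZ -inv_piD scalerDr.
Qed.
Lemma inv_scaleDl x : {morph inv_scale^~ x : c d / c + d}.
Proof. by move=> c d; rewrite -(inv_piK x) !inv_piZ -inv_piD scalerDl. Qed.

HB.instance Definition _ :=
  GRing.Zmodule_isLmodule.Build K inv_Gamma inv_scaleA inv_scale1 inv_scaleDr inv_scaleDl.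

(* the map induced by varpi, an isomorphism onto Lhat for q other than 0, 1, -1 *)
Definition varpi_bar (x : inv_Gamma) : Lhat := varpi q (repr x).

Lemma varpi_bar_pi g : varpi_bar (inv_pi g) = varpi q g.
Proof. exact: inv_repr. Qed.

Lemma varpi_bar_linear : linear varpi_bar.
Proof.
move=> c x y; rewrite -(inv_piK x) -(inv_piK y).
have -> : c *: inv_pi (repr x) = inv_pi (c *: repr x) by exact: inv_piZ.
by rewrite -inv_piD !varpi_bar_pi linearP.
Qed.
HB.instance Definition _ :=
  GRing.isLinear.Build K inv_Gamma Lhat *:%R varpi_bar varpi_bar_linear.

Lemma varpi_bar_inj : injective varpi_bar.
Proof. by move=> x y E; rewrite -(inv_piK x) -(inv_piK y); apply/inv_piP. Qed.

Lemma counit_zpow n : counit (zpow n) = 1.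
Proof.
rewrite /counit (@fsbigTE _ _ _ _ [fset n]%fset) => [|k].
  by rewrite big_seq_fset1 /= eqxx.
by rewrite in_fset1 /= => /negbTE ->.
Qed.

Lemma pairing_zpow2 m n : pairing q (zpow m) (zpow n) = (q ^ (2 * m * n))%:C.
Proof.
rewrite pairing_zpow (@fsbigTE _ _ _ _ [fset m]%fset) => [|k].
  by rewrite big_seq_fset1 /= eqxx mul1r.
by rewrite in_fset1 /= => /negbTE ->; rewrite mul0r.
Qed.

Lemma ker_counit_zpow n : zpow n - zpow 0 \in ker_counit_pred.
Proof. by apply/eqP; rewrite linearB /= !counit_zpow subrr. Qed.
Definition zker n : ker_counit := KerCounit (ker_counit_zpow n).

(* vtheta 0 is vartheta^e = -i theta_- and vtheta 1 is vartheta^m = -i theta_+,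
   seen in Ker(counit) / Ker(varpi) *)
Definition vtheta (a : 'I_2) : inv_Gamma :=
  xget 0 [set x | varpi_bar x = - 'i%C *: (if a == 0 then theta_m else theta_p)]%classic.

(* the coordinates with respect to (vtheta 0, vtheta 1) *)
Definition coord (a : 'I_2) (x : inv_Gamma) : K := 'i%C * varpi_bar x 0 a.

Lemma coord_linear a : linear_for *%R (coord a).
Proof. by move=> c x y; rewrite /coord linearP !mxE mulrDr mulrCA. Qed.
HB.instance Definition _ a :=
  GRing.isLinear.Build K inv_Gamma K *%R (coord a) (coord_linear a).

Hypotheses (q0 : q != 0) (q1 : q != 1) (qN1 : q != -1).

Lemma varpi_zker n : varpi q (zker n) =
  \row_(j < 2) ((q ^ (2 * n * (if j == 0 then 1 else -1)) - 1)%:C).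
Proof.
apply/rowP => j; rewrite /= linearB /= !mxE !pairing_zpow2 mulr0 mul0r expr0z.
by rewrite rmorphB.
Qed.

Lemma varpi_bar_surj (v : Lhat) : exists x, varpi_bar x = v.
Proof.
pose a : R := q ^+ 2 - 1; pose b : R := q ^- 2 - 1.
have ab : a ^+ 2 - b ^+ 2 != 0.
  have -> : a ^+ 2 - b ^+ 2 = (q - 1) ^+ 3 * (q + 1) ^+ 3 * (q ^+ 2 + 1) / q ^+ 4.
    by rewrite /a /b; field.
  have h1 : q - 1 != 0 by rewrite subr_eq0.
  have h2 : q + 1 != 0 by rewrite addr_eq0.
  have h3 : q ^+ 2 + 1 != 0 by rewrite lt0r_neq0 // ltr_wpDl // sqr_ge0.
  by rewrite !mulf_neq0 ?invr_neq0 ?expf_neq0.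
pose D : K := ((a ^+ 2 - b ^+ 2)^-1)%:C.
pose s : K := D * (a%:C * v 0 0 - b%:C * v 0 1).
pose t : K := D * (a%:C * v 0 1 - b%:C * v 0 0).
exists (inv_pi (s *: zker 1 + t *: zker (-1))).
rewrite varpi_bar_pi.
have -> : varpi q (s *: zker 1 + t *: zker (-1)) =
    s *: varpi q (zker 1) + t *: varpi q (zker (-1)).
  by rewrite -!linearZ -linearD.
have DK : D * (a%:C ^+ 2 - b%:C ^+ 2) = 1.
  by rewrite -!rmorphXn -rmorphB -rmorphM mulVf.
rewrite !varpi_zker; apply/rowP => j; rewrite !mxE.
have [e1 e2] : (q ^ 2 - 1 = a) /\ (q ^ (-2) - 1 = b) by [].
case: (j =P 0) => [->|/eqP j0] /=.
  rewrite !mulr1 mulrN1 e1 e2 /s /t -[RHS]mul1r -DK; ring.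
have -> : j = 1 by apply/val_inj; case: j j0 => [[|[|]]].
rewrite !mulr1 !mulrN1 opprK e1 e2 /s /t -[RHS]mul1r -DK; ring.
Qed.

Lemma varpi_bar_vtheta a :
  varpi_bar (vtheta a) = - 'i%C *: (if a == 0 then theta_m else theta_p).
Proof.
rewrite /vtheta; case: xgetP => [x -> //|/= nE].
by have [x Hx] := varpi_bar_surj (- 'i%C *: (if a == 0 then theta_m else theta_p)); case: (nE x).
Qed.

Lemma coord_vtheta a b : coord a (vtheta b) = (a == b)%:R.
Proof.
rewrite /coord varpi_bar_vtheta !mxE mulrA mulrN -expr2.
have -> : 'i%C ^+ 2 = -1 :> K by exact: sqr_i.
rewrite opprK mul1r; case: a b => [[|[|a]]// ha] [[|[|b]]// hb]; rewrite /= !mxE //=.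
Qed.

Lemma inv_GammaE x : x = \sum_a coord a x *: vtheta a.
Proof.
apply: varpi_bar_inj; apply/rowP => j.
have K1 y : varpi_bar y 0 j = - 'i%C * coord j y.
  rewrite /coord mulrA mulNr -expr2.
  have -> : 'i%C ^+ 2 = -1 :> K by exact: sqr_i.
  by rewrite opprK mul1r.
rewrite !K1 linear_sum (bigD1 j) //= linearZ /= coord_vtheta eqxx mulr1.
rewrite big1 ?addr0 // => a aj; rewrite linearZ /= coord_vtheta.
by rewrite eq_sym (negbTE aj) mulr0.
Qed.

End InvGamma.
End StructureGroup.

Section Gauge.
Variables (R : realType) (S : {set 'I_4 * 'I_4}) (q : R).
Notation K := R[i].
Notation G := (inv_Gamma q).
Notation exterior := (exterior R S).
Notation vt := (@vtheta R q).

Definition gauge_potential := {linear G -> Omega R S 1}.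

(* the linear map with prescribed values v a at vtheta a *)
Definition linext (v : 'I_2 -> exterior) (x : G) : exterior := \sum_a coord a x *: v a.

(* The embedded differential; the matrix M encodes
   sum_{a, b} M a b (vtheta a (x) vtheta b). *)
Definition Theta (x : G) : 'M[K]_2 :=
  (coord 0 x + coord 1 x) *: ('i%C *: (delta_mx 0 1 + delta_mx 1 0)).

Section Potential.
Variable A : gauge_potential.

Definition field_strength (x : G) : exterior :=
  dext (A x) - \sum_a \sum_b Theta x a b *: wedge (A (vt a)) (A (vt b)).

(* As star is antilinear, the pointwise composite of star and a linear map is not
   linear; star T is the linear map with values star (T (vtheta a)). *)
Definition star_map (T : G -> exterior) : G -> exterior := linext (fun a => star (T (vt a))).

Definition instanton : Prop :=
  forall x, star_map field_strength x = - field_strength x.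

(* the formal adjoint of d^S, on linear maps of degree k.+1 *)
Definition dS_adj (k : nat) (T : G -> exterior) : G -> exterior := linext (fun a =>
  ((-1) ^+ k * 'i%C) *:
    starinv (gcomm (3 - k) (A (vt (rev_ord a))) (star (T (vt 0) + T (vt 1))))).

Definition YM_operator (x : G) : exterior :=
  codiff 1 (field_strength x) - dS_adj 1 field_strength x.

Definition YM_solution : Prop := YM_operator (vt 0) = 0 /\ YM_operator (vt 1) = 0.

(* the coefficient of dx^mu /\ dx^nu, for mu < nu *)
Definition comp (a : exterior) (mu nu : 'I_4) : moyal_alg R S := a [set mu; nu].

Definition electric (a : exterior) : 'I_3 -> moyal_alg R S :=
  fun j => comp a 0 (lift ord0 j).
Definition magnetic (a : exterior) : 'I_3 -> moyal_alg R S := fun j =>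
  match val j with
  | 0 => - comp a 2 3
  | 1 => comp a 1 3
  | _ => - comp a 1 2
  end.

Definition De := electric (field_strength (vt 0)).
Definition He := magnetic (field_strength (vt 0)).
Definition Hm := electric (field_strength (vt 1)).
Definition Dm := magnetic (field_strength (vt 1)).

End Potential.
End Gauge.

(* Main.v *)
From Pilot Require Import Defs.
From HB Require Import structures.
From mathcomp Require Import all_boot all_order all_algebra.
From mathcomp Require Import ring complex.
From mathcomp Require Import boolp reals topology normedtype derive.
Set Implicit Arguments.
Unset Strict Implicit.
Unset Printing Implicit Defensive.
Import Order.TTheory GRing.Theory Num.Theory.
Import numFieldNormedType.Exports.
Local Open Scope ring_scope.

(** The gauge group sees the noncommutativity of the base through commutators
    only. Take a potential whose magnetic component vanishes: A (vartheta^e) = E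
    and A (vartheta^m) = 0. The quadratic terms of the field strength all contain
    a factor A (vartheta^m), so that F^e = dE and F^m = 0, and being an instanton
    becomes the linear condition that dE be anti-self-dual. On the other hand,
    in the Yang-Mills equation at vartheta^m the codifferential of F^m drops out,
    and what remains is the commutator of E with star F^e = - dE
    ([electric_instanton], [electric_YM]). For a commutative base this
    commutator is 0; over the Moyal-Weyl algebra it need not be.

    It remains to find a real E with dE anti-self-dual and [E, dE] <> 0. Choose a
    parameter theta^{ab} that has not been set to zero, and complete a, b by c, d
    to a positively oriented frame. Put
      E = u dx^c + v dx^d,  u + i v = (x^a + i x^b)^2.
    As u and v depend on x^a and x^b only, anti-self-duality of dE is the pair of
    Cauchy-Riemann equations for u + i v ([cr_oneform_asd]). The coefficient of
    theta^{ab} in a Moyal commutator of functions free of theta is i times their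
    Poisson bracket in (x^a, x^b) ([moyal_commutator_mon1]), and in the
    component dx^a dx^c dx^d of [E, - dE] these brackets add up to 8 x^a, which
    is not the zero function ([cr_oneform_gcomm]).

    The three characterizations of instantons follow from the linearity of the
    field strength ([instanton_basis]) and from reading star F = - F on the six
    coordinate planes ([star_asd_fields]). *)

(** * Smooth functions and their partial derivatives *)

Section SmoothCalculus.
Variable R : realType.
Implicit Types (f g : smooth_fun R) (mu nu : 'I_4) (x : 'rV[R]_4).

Lemma smooth_funP f g : (forall x, f x = g x) -> f = g.
Proof. by move=> fg; apply/val_inj/funext. Qed.

Lemma smooth_funD f g x : (f + g) x = f x + g x. Proof. by []. Qed.
Lemma smooth_funM f g x : (f * g) x = f x * g x. Proof. by []. Qed.
Lemma smooth_funZ (c : R[i]) f x : (c *: f) x = c * f x. Proof. by []. Qed.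

Lemma smooth_scaleAr (c : R[i]) f g : f * (c *: g) = c *: (f * g).
Proof. by apply: smooth_funP => x; rewrite !(smooth_funM, smooth_funZ) mulrCA. Qed.

Lemma complex_ReD (y z : R[i]) : complex.Re (y + z) = complex.Re y + complex.Re z.
Proof. by case: y z => [? ?] [? ?]. Qed.
Lemma complex_ImD (y z : R[i]) : complex.Im (y + z) = complex.Im y + complex.Im z.
Proof. by case: y z => [? ?] [? ?]. Qed.

Lemma is_derive_ext (F G : 'rV[R]_4 -> R) x v d :
  F =1 G -> is_derive x v F d -> is_derive x v G d.
Proof. by move=> /funext <-. Qed.

Lemma is_derive_parts f mu x :
  is_derive x (axis R mu) (fun y => complex.Re (f y)) (complex.Re (pd mu f x)) /\
  is_derive x (axis R mu) (fun y => complex.Im (f y)) (complex.Im (pd mu f x)).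
Proof.
have /smoothP[/smooth_realP[_ /(_ mu)[dr _]] /smooth_realP[_ /(_ mu)[di _]]] := valP f.
by split; apply: derivableP.
Qed.

Lemma pd_eq f mu x (dr di : R) :
  is_derive x (axis R mu) (fun y => complex.Re (f y)) dr ->
  is_derive x (axis R mu) (fun y => complex.Im (f y)) di ->
  pd mu f x = Complex dr di.
Proof. by move=> Hr Hi; congr Complex; exact: derive_val. Qed.

(** A complex function is differentiated through its real and imaginary parts, so
    the Leibniz rule is the real one applied to the four products of the parts. *)
Lemma pdM mu f g : pd mu (f * g) = pd mu f * g + f * pd mu g.
Proof.
apply: smooth_funP => x.
have [fr fi] := is_derive_parts f mu x; have [gr gi] := is_derive_parts g mu x.
rewrite smooth_funD !smooth_funM.
apply/eqP; rewrite eq_complex; apply/andP.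
have -> : pd mu (f * g) x = Complex
  ((complex.Re (f x) * complex.Re (pd mu g x) + complex.Re (g x) * complex.Re (pd mu f x))
   - (complex.Im (f x) * complex.Im (pd mu g x) + complex.Im (g x) * complex.Im (pd mu f x)))
  ((complex.Re (f x) * complex.Im (pd mu g x) + complex.Im (g x) * complex.Re (pd mu f x))
   + (complex.Im (f x) * complex.Re (pd mu g x) + complex.Re (g x) * complex.Im (pd mu f x))).
  apply: pd_eq.
    apply: (is_derive_ext (fun y => esym (Defs.ReM (f y) (g y)))).
    exact: (is_deriveB (is_deriveM fr gr) (is_deriveM fi gi)).
  apply: (is_derive_ext (fun y => esym (Defs.ImM (f y) (g y)))).
  exact: (is_deriveD (is_deriveM fr gi) (is_deriveM fi gr)).
case: (f x) (g x) (pd mu f x) (pd mu g x) => [? ?] [? ?] [? ?] [? ?] /=.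
by split; apply/eqP; ring.
Qed.

Lemma pdD mu f g : pd mu (f + g) = pd mu f + pd mu g.
Proof.
apply: smooth_funP => x.
have [fr fi] := is_derive_parts f mu x; have [gr gi] := is_derive_parts g mu x.
rewrite smooth_funD.
have -> : pd mu (f + g) x = Complex
  (complex.Re (pd mu f x) + complex.Re (pd mu g x))
  (complex.Im (pd mu f x) + complex.Im (pd mu g x)).
  apply: pd_eq.
    by apply: (is_derive_ext (fun y => esym (complex_ReD (f y) (g y)))).
  by apply: (is_derive_ext (fun y => esym (complex_ImD (f y) (g y)))).
by case: (pd mu f x) (pd mu g x) => [? ?] [? ?].
Qed.

Definition const_fun (c : R[i]) : smooth_fun R := SmoothFun (smooth_cst c).

Lemma pd_const mu c : pd mu (const_fun c) = 0.
Proof.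
by apply: smooth_funP => x; apply: (@pd_eq _ _ _ 0 0); exact: is_derive_cst.
Qed.

(** Complex scalars mix the real and imaginary parts; writing c *: f as the product
    with a constant function reduces homogeneity to the Leibniz rule. *)
Lemma pd_is_linear mu : linear (@pd R mu).
Proof.
move=> c f g; have -> : c *: f = const_fun c * f by exact: smooth_funP.
by rewrite pdD pdM pd_const mul0r add0r; congr (_ + _); exact: smooth_funP.
Qed.
HB.instance Definition _ mu :=
  GRing.isLinear.Build R[i] (smooth_fun R) (smooth_fun R) *:%R (@pd R mu) (@pd_is_linear mu).

Lemma pd0 mu : pd mu 0 = 0 :> smooth_fun R.
Proof. exact: linear0. Qed.

(** A coordinate is a continuous linear map, hence its own differential. *)
Lemma is_derive_coord mu nu x :
  is_derive x (axis R mu) (fun y : 'rV[R]_4 => y 0 nu) (mu == nu)%:R.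
Proof.
have dc := @differentiable_coord R 1 4 x 0 nu.
apply: DeriveDef; first exact: diff_derivable.
rewrite deriveE //.
have -> : 'd (fun y : 'rV[R]_4 => y 0 nu) x = (fun y : 'rV[R]_4 => y 0 nu) :> (_ -> _).
  pose h := fun y : 'rV[R]_4 => y 0 nu : R.
  have hl : linear h by move=> c y z; rewrite /h !mxE.
  pose H : {linear 'rV[R]_4 -> R} := HB.pack h (GRing.isLinear.Build _ _ _ _ h hl).
  exact: (@diff_lin _ _ _ H x (@coord_continuous R 1 4 0 nu)).
by rewrite mxE eqxx eq_sym.
Qed.

Lemma coord_smooth nu : (fun x : 'rV[R]_4 => (x 0 nu)%:C%C) \in @smooth R.
Proof.
apply/smoothP; split; last exact: (@smooth_real_cst R 0).
apply/smooth_realP; split=> [|mu]; first exact: coord_continuous.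
split=> [x|]; first by case: (is_derive_coord mu nu x).
rewrite (_ : 'D_(axis R mu) _ = fun=> ((mu == nu)%:R : R)); first exact: smooth_real_cst.
by apply/funext => x; case: (is_derive_coord mu nu x).
Qed.
Definition coordX nu : smooth_fun R := SmoothFun (coord_smooth nu).

Lemma pd_coordX mu nu : pd mu (coordX nu) = (mu == nu)%:R.
Proof.
apply: smooth_funP => x.
have -> : pd mu (coordX nu) x = Complex (mu == nu)%:R 0.
  by apply: pd_eq; [exact: is_derive_coord|exact: is_derive_cst].
by case: eqP.
Qed.

Lemma coordX_neq0 nu : coordX nu != 0.
Proof.
apply/eqP => /(congr1 (fun f : smooth_fun R => complex.Re (f (axis R nu)))) /= /eqP.
by rewrite mxE !eqxx oner_eq0.
Qed.

Lemma sconjD f g : sconj (f + g) = sconj f + sconj g.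
Proof. by apply: smooth_funP => x; exact: (rmorphD (@conjc R)). Qed.
Lemma sconjM f g : sconj (f * g) = sconj f * sconj g.
Proof. by apply: smooth_funP => x; exact: (rmorphM (@conjc R)). Qed.
Lemma sconjN f : sconj (- f) = - sconj f.
Proof. by apply: smooth_funP => x; exact: (rmorphN (@conjc R)). Qed.
Lemma sconj_coordX nu : sconj (coordX nu) = coordX nu.
Proof. by apply: smooth_funP => x /=; rewrite oppr0. Qed.

Lemma sconj_pd mu f : sconj (pd mu f) = pd mu (sconj f).
Proof.
apply: smooth_funP => x; have [fr fi] := is_derive_parts f mu x.
have conjE (z : R[i]) : conjc z = Complex (complex.Re z) (- complex.Im z) by case: z.
rewrite [LHS]conjE; apply/esym/pd_eq.
  by apply: (is_derive_ext _ fr) => y; rewrite [sconj f y]conjE.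
by apply: (is_derive_ext _ (is_deriveN fi)) => y; rewrite [sconj f y]conjE.
Qed.

End SmoothCalculus.

(** * Signs, the Hodge star and anti-self-duality *)

Section Exterior.
Variables (R : realType) (S : {set 'I_4 * 'I_4}).
Notation K := R[i].
Implicit Types (a b : exterior R S) (I J : {set 'I_4}) (x y z w : 'I_4).

(** The sign that sorts dx^x dx^y. *)
Definition sgn x y : K := (-1) ^+ (y < x)%N.

Lemma sgnC x y : x != y -> sgn y x = - sgn x y.
Proof.
rewrite -val_eqE /sgn => xy; case: ltngtP xy => //= _ _;
  by rewrite ?expr0 ?expr1 ?opprK.
Qed.

(** Every sign of the exterior calculus becomes a product of the signs of pairs of
    indices, so that sign identities are identities between such products, with
    antisymmetry [sgnC] as their only other ingredient. *)
Lemma ext_signE I J : ext_sign R I J = \prod_(i in I) \prod_(j in J) sgn i j.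
Proof.
rewrite pair_big /= /sgn prodrXr /ext_sign; congr (_ ^+ _).
rewrite -sum1_card; under eq_bigl do rewrite inE andbA.
by rewrite big_mkcondr.
Qed.

Lemma prod_set2 (F : 'I_4 -> K) x y : x != y -> \prod_(i in [set x; y]) F i = F x * F y.
Proof. by move=> xy; rewrite big_setU1 ?inE // big_set1. Qed.

Lemma homog0 k a I : a \in homog k -> #|I| != k -> a I = 0.
Proof. by move=> /asboolP h /eqP; exact: h. Qed.

Lemma mpd_is_linear mu : linear (@mpd R S mu).
Proof. by move=> c f g; apply/funext => m; exact: (linearP (pd mu)). Qed.
HB.instance Definition _ mu :=
  GRing.isLinear.Build K (moyal_alg R S) (moyal_alg R S) *:%R (@mpd R S mu) (@mpd_is_linear mu).

Lemma dext_is_linear : linear (@dext R S).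
Proof.
move=> c a b; apply/funext => J.
rewrite -[RHS]/(c *: dext a J + dext b J) /dext scaler_sumr -big_split; apply: eq_bigr => mu _ /=.
by rewrite -[(c *: a + b) _]/(c *: a _ + b _) linearP scalerDr !scalerA mulrC.
Qed.
HB.instance Definition _ :=
  GRing.isLinear.Build K (exterior R S) (exterior R S) *:%R (@dext R S) dext_is_linear.

Lemma dext_homog k a : a \in homog k -> dext a \in homog k.+1.
Proof.
move=> ha; apply/asboolP => J Jk; apply: big1 => mu muJ.
rewrite (homog0 ha) ?linear0 ?scaler0 //.
by apply/eqP => E; apply: Jk; rewrite (cardsD1 mu) muJ E.
Qed.

Lemma dext_pair a x y : x != y ->
  dext a [set x; y] = sgn x y *: mpd x (a [set y]) + sgn y x *: mpd y (a [set x]).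
Proof.
move=> xy; rewrite /dext big_setU1 ?inE // big_set1.
have -> : [set x; y] :\ x = [set y].
  by apply/setP => i; rewrite !inE; case: eqP => // ->; rewrite (negbTE xy).
have -> : [set x; y] :\ y = [set x].
  apply/setP => i; rewrite !inE; case: (i =P y) => [->|]; rewrite ?orbF //.
  by rewrite eq_sym (negbTE xy).
by rewrite !ext_signE !big_set1.
Qed.

Lemma star_pair a x y z w : x != y -> z != w -> ~: [set x; y] = [set z; w] ->
  star a [set x; y] = (sgn z x * sgn z y * (sgn w x * sgn w y)) *: mconj (a [set z; w]).
Proof. by move=> xy zw E; rewrite /star E ext_signE prod_set2 // !prod_set2. Qed.

Lemma mconj0 : mconj 0 = 0 :> moyal_alg R S.
Proof. by apply/funext => m; apply: smooth_funP => x; exact: (rmorph0 (@conjc R)). Qed.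

Lemma star_homog2 a : a \in homog 2 -> star a \in homog 2.
Proof.
move=> ha; apply/asboolP => J J2; rewrite /star (homog0 ha).
  by rewrite mconj0 scaler0.
apply/eqP => E; apply: J2.
by have := cardsC J; rewrite E card_ord => /(@addIn 2 #|J| 2).
Qed.

Definition distinct4 x y z w :=
  [&& x != y, x != z, x != w, y != z, y != w & z != w].

Lemma setC_pair x y z w : distinct4 x y z w -> ~: [set x; y] = [set z; w].
Proof.
case/and5P => xy xz xw yz /andP[yw zw]; apply/esym/eqP; rewrite eqEcard.
rewrite subUset !sub1set !inE !negb_or !(eq_sym z) !(eq_sym w) xz yz xw yw /=.
by rewrite cardsCs finset.setCK !cards2 xy zw card_ord.
Qed.

(** Two-forms in dimension four are checked on the six planes of a frame. *)
Lemma pair_ind4 x y z w (P : {set 'I_4} -> Prop) : distinct4 x y z w ->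
  P [set x; y] -> P [set x; z] -> P [set x; w] ->
  P [set y; z] -> P [set y; w] -> P [set z; w] -> forall J, #|J| = 2 -> P J.
Proof.
move=> xyzw Pxy Pxz Pxw Pyz Pyw Pzw J /eqP/cards2P[i [j [ij ->]]].
have full k : [|| k == x, k == y, k == z | k == w].
  have /setP/(_ k) := setC_pair xyzw; rewrite !inE negb_or.
  by case: (k == x) (k == y) => [] [] //= <-.
case/or4P: (full i) ij => /eqP->; case/or4P: (full j) => /eqP->;
  by rewrite ?eqxx // => _; rewrite 1?finset.setUC.
Qed.

Lemma homog2_eq a b : a \in homog 2 -> b \in homog 2 ->
  (forall J, #|J| = 2 -> a J = b J) -> a = b.
Proof.
move=> ha hb ab; apply/funext => J.
by case: (eqVneq #|J| 2) => [/ab //|J2]; rewrite (homog0 ha) // (homog0 hb).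
Qed.

Lemma mconjN (f : moyal_alg R S) : mconj (- f) = - mconj f.
Proof. by apply/funext => m; exact: sconjN. Qed.

(** Of the six equations star a = - a, those on the planes 23, 13, 12 are the three
    equations between the fields; those on 01, 02, 03 are their conjugates. *)
Lemma star_asd_fields a : a \in homog 2 ->
  star a = - a <-> forall j, mconj (electric a j) = magnetic a j.
Proof.
move=> ha.
have starE (x y z w : 'I_4) : distinct4 x y z w ->
  star a [set x; y] = (sgn z x * sgn z y * (sgn w x * sgn w y)) *: mconj (a [set z; w]).
  by move=> xyzw; apply: star_pair (setC_pair xyzw); case/and5P: xyzw => // _ _ _ _ /andP[].
have s01 := starE 0 1 2 3 isT; have s02 := starE 0 2 1 3 isT; have s03 := starE 0 3 1 2 isT.
have s12 := starE 1 2 0 3 isT; have s13 := starE 1 3 0 2 isT; have s23 := starE 2 3 0 1 isT.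
rewrite /sgn /= !(expr0, expr1, mulr1, mul1r, mulrN, mulNr, opprK, scaleNr, scale1r)
  in s01 s02 s03 s12 s13 s23.
have [e0 e1 e2] : [/\ forall h, lift ord0 (@Ordinal 3 0 h) = 1 :> 'I_4,
    forall h, lift ord0 (@Ordinal 3 1 h) = 2 :> 'I_4
  & forall h, lift ord0 (@Ordinal 3 2 h) = 3 :> 'I_4].
  by split=> h; apply/val_inj.
have oppE (b : exterior R S) J : (- b) J = - b J by [].
split=> [E [[|[|[|//]]] hj]|H]; rewrite /electric /magnetic /comp.
- by rewrite e0 /= -s23 E.
- by rewrite e1 /= -[LHS]opprK -s13 E oppE opprK.
- by rewrite e2 /= -s12 E.
have {e0}h0 : mconj (a [set 0; 1]) = - a [set 2; 3].
  by have := H (@Ordinal 3 0 isT); rewrite /electric e0.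
have {e1}h1 : mconj (a [set 0; 2]) = a [set 1; 3].
  by have := H (@Ordinal 3 1 isT); rewrite /electric e1.
have {e2}h2 : mconj (a [set 0; 3]) = - a [set 1; 2].
  by have := H (@Ordinal 3 2 isT); rewrite /electric e2.
have [h3 h4 h5] : [/\ mconj (a [set 2; 3]) = - a [set 0; 1],
    mconj (a [set 1; 3]) = a [set 0; 2] & mconj (a [set 1; 2]) = - a [set 0; 3]].
  by split; apply: (inv_inj (@mconjK _ _)); rewrite ?mconjN ?mconjK ?h0 ?h1 ?h2 ?opprK.
apply: homog2_eq => [||J J2]; rewrite ?rpredN ?star_homog2 // oppE.
by apply: (@pair_ind4 0 1 2 3 (fun J => star a J = - a J)) J2;
  rewrite ?(s01, s02, s03, s12, s13, s23) ?h0 ?h1 ?h2 ?h3 ?h4 ?h5.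
Qed.

End Exterior.

(** * The Moyal product to first order *)

Section MoyalProduct.
Variables (R : realType) (S : {set 'I_4 * 'I_4}).
Notation K := R[i].
Implicit Types (f g : smooth_fun R) (a b : exterior R S) (m : mon S).

Lemma pds0 s : pds s 0 = 0 :> smooth_fun R.
Proof. by elim: s => //= mu s ->; rewrite linear0. Qed.

Lemma moyal_coef0l m g : moyal_coef m 0 g = 0.
Proof.
by rewrite /moyal_coef big1 ?scaler0 // => w _; rewrite pds0 mul0r scaler0.
Qed.
Lemma moyal_coef0r m f : moyal_coef m f 0 = 0.
Proof.
by rewrite /moyal_coef big1 ?scaler0 // => w _; rewrite pds0 mulr0 scaler0.
Qed.

Lemma moyal0l (g : moyal_alg R S) : moyal 0 g = 0.
Proof. by apply/funext => m; apply: big1 => t _; exact: moyal_coef0l. Qed.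
Lemma moyal0r (f : moyal_alg R S) : moyal f 0 = 0.
Proof. by apply/funext => m; apply: big1 => t _; exact: moyal_coef0r. Qed.

Lemma wedge0l b : wedge 0 b = 0.
Proof. by apply/funext => J; apply: big1 => I _; rewrite moyal0l scaler0. Qed.
Lemma wedge0r a : wedge a 0 = 0.
Proof. by apply/funext => J; apply: big1 => I _; rewrite moyal0r scaler0. Qed.

Lemma wedge_homog k l a b : a \in homog k -> b \in homog l -> wedge a b \in homog (k + l).
Proof.
move=> ha hb; apply/asboolP => J Jkl; apply: big1 => I IJ.
have [Ik|Ik] := eqVneq #|I| k; last by rewrite (homog0 ha) // moyal0l scaler0.
rewrite (homog0 hb) ?moyal0r ?scaler0 //; apply/eqP => Jl; apply: Jkl.
by rewrite -(cardsID I) -Jl -Ik (setIidPr IJ).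
Qed.

Lemma mon_of_inj m : injective (@mon_of S m).
Proof.
by move=> b c /ffunP E; apply/ffunP => p; have := E p; rewrite !ffunE => /val_inj.
Qed.

Definition mon0 : mon S := [ffun=> 0%N].

(** A function without theta, seen as a power series in theta. *)
Definition const_series f : moyal_alg R S := fun m => if m == mon0 then f else 0.

Lemma const_series_is_linear : linear const_series.
Proof.
move=> c f g; apply/funext => m.
rewrite -[RHS]/(c *: const_series f m + const_series g m) /const_series.
by case: eqP => // _; rewrite scaler0 addr0.
Qed.
HB.instance Definition _ := GRing.isLinear.Build K (smooth_fun R) (moyal_alg R S) *:%R
  const_series const_series_is_linear.

Lemma const_series_at0 f : const_series f mon0 = f.
Proof. by rewrite /const_series eqxx. Qed.

Lemma const_series_neq f m : m != mon0 -> const_series f m = 0.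
Proof. by rewrite /const_series => /negbTE ->. Qed.

(** When both factors are free of theta, all of theta^m has to come from the
    exponential: among the triples of monomials only (1, 1, theta^m) remains. *)
Lemma moyal_const f g m : moyal (const_series f) (const_series g) m = moyal_coef m f g.
Proof.
pose z : mon_le m := [ffun=> ord0].
have mdegP p : (m p < (mdeg m).+1)%N by rewrite ltnS /mdeg (bigD1 p) //= leq_addr.
pose t : mon_le m := [ffun p => Ordinal (mdegP p)].
have zE : mon_of z = mon0 by apply/ffunP => p; rewrite !ffunE.
have tE : mon_of t = m by apply/ffunP => p; rewrite !ffunE.
rewrite /moyal (bigD1 (z, z, t)) /=; last by apply/forallP => p; rewrite !ffunE.
rewrite zE tE !const_series_at0 big1 ?addr0 // => -[[b c] e] /andP[/forallP bce nz] /=.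
have [b0|b0] := eqVneq (mon_of b) mon0; last by rewrite const_series_neq ?moyal_coef0l.
have [c0|c0] := eqVneq (mon_of c) mon0; last first.
  by rewrite (const_series_neq _ c0) moyal_coef0r.
case/eqP: nz; congr (_, _, _); apply: mon_of_inj; rewrite ?zE // tE.
apply/ffunP => p; have /eqP <- := bce p.
by have := congr1 (fun n : mon S => n p) b0; have := congr1 (fun n : mon S => n p) c0;
  rewrite !ffunE /= => -> ->.
Qed.

Definition mon1 (p : param S) : mon S := [ffun p' => (p' == p) : nat].

Lemma mdeg_mon1 p : mdeg (mon1 p) = 1%N.
Proof.
rewrite /mdeg (bigD1 p) //= ffunE eqxx big1 // => p' /negbTE p'p.
by rewrite ffunE p'p.
Qed.

Lemma sum_tuple1 (T : finType) (V : zmodType) (F : seq T -> V) :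
  \sum_(w : 1.-tuple T) F w = \sum_l F [:: l].
Proof.
rewrite (reindex (fun l => [tuple l])) //=.
exists (fun w => thead w) => [l _|w _]; first by [].
by apply/val_inj; case: w => [[|l [|]]].
Qed.

Hypothesis S_lt : forall p, p \in S -> (p.1 < p.2)%N.

(** A parameter p = (i, j) with i < j is only reached by the letters (i, j) and
    (j, i), the second with the sign of antisymmetry. The ordering of the pairs in
    S excludes that a letter belongs to two parameters. *)
Lemma theta_coef_letter p l : theta_coef R [:: l] (mon1 p) =
  (l == val p)%:R - (l == ((val p).2, (val p).1))%:R.
Proof.
have letterP (p' : param S) : is_letter p' l -> val p' = if (l.1 < l.2)%N then l else (l.2, l.1).
  have := S_lt (valP p'); rewrite /is_letter; case: (val p') => i j /= ij.
  by case/orP => /eqP -> /=; rewrite ?ij // ltnNge ltnW.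
have [pl|pl] := boolP (is_letter p l); last first.
  move: (pl); rewrite /is_letter negb_or => /andP[/negbTE-> /negbTE->]; rewrite subrr.
  rewrite /theta_coef; case: ifP => // /andP[_ /forallP/(_ p)].
  by rewrite /= (negbTE pl) ffunE eqxx.
have -> : theta_coef R [:: l] (mon1 p) = (-1) ^+ (l.2 < l.1)%N.
  rewrite /theta_coef /= addn0 ifT // andbT; apply/andP; split; first by apply/existsP; exists p.
  apply/forallP => p'; rewrite addn0 ffunE.
  case: (eqVneq p' p) => [->|p'p]; first by rewrite pl.
  apply/eqP; case: (boolP (is_letter p' l)) => // p'l; case/eqP: p'p.
  by apply/val_inj; rewrite (letterP _ pl) (letterP _ p'l).
have := S_lt (valP p); move: pl; rewrite /is_letter; case: (val p) => i j /= + ij.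
have ji : (j < i)%N = false by rewrite ltnNge ltnW.
case/orP => /eqP -> /=; rewrite ?ij ?ji eqxx xpair_eqE.
  by rewrite (negbTE (_ : i != j)) ?subr0 // -val_eqE neq_ltn ij.
by rewrite (negbTE (_ : j != i)) ?sub0r // -val_eqE neq_ltn ij orbT.
Qed.

Lemma moyal_coef_mon1 p f g : moyal_coef (mon1 p) f g =
  ('i%C / 2) *: (pd (val p).1 f * pd (val p).2 g - pd (val p).2 f * pd (val p).1 g).
Proof.
rewrite /moyal_coef; move: (mdeg _) (mdeg_mon1 p) => n En; rewrite {n}En.
have /= -> := sum_tuple1 (fun w : seq ('I_4 * 'I_4) => theta_coef R w (mon1 p) *:
  (pds [seq l.1 | l <- w] f * pds [seq l.2 | l <- w] g)).
rewrite expr1 divr1; congr (_ *: _).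
under eq_bigr do rewrite theta_coef_letter scalerBl /=.
rewrite sumrB; congr (_ - _).
  rewrite (bigD1 (val p)) //= eqxx scale1r big1 ?addr0 // => l /negbTE ->.
  by rewrite scale0r.
rewrite (bigD1 ((val p).2, (val p).1)) //= eqxx scale1r big1 ?addr0 // => l /negbTE ->.
by rewrite scale0r.
Qed.

End MoyalProduct.

(** * Commutators of one-forms and two-forms *)

Section ConstantOneForms.
Variables (R : realType) (S : {set 'I_4 * 'I_4}).
Hypothesis S_lt : forall p, p \in S -> (p.1 < p.2)%N.
Notation K := R[i].
Notation sgn := (@sgn R).
Notation const_series := (@const_series R S).
Implicit Types (e g : 'I_4 -> smooth_fun R) (x y z w : 'I_4) (I J : {set 'I_4}).

Lemma sum_singletons (V : zmodType) J (G : {set 'I_4} -> V) :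
  \sum_(I : {set 'I_4} | (I \subset J) && (#|I| == 1%N)) G I = \sum_(i in J) G [set i].
Proof.
rewrite -(@big_imset _ _ _ _ _ (@set1 _) (mem J) G) => [|i j _ _]; last exact: finset.set1_inj.
apply: eq_bigl => I; apply/andP/imsetP => [[IJ /cards1P[i Ii]]|[i iJ ->]].
  by exists i => //; rewrite -sub1set -Ii.
by rewrite sub1set iJ cards1.
Qed.

Lemma wedge1E (a b : exterior R S) J : a \in homog 1 ->
  wedge a b J = \sum_(i in J) ext_sign R [set i] (J :\ i) *: moyal (a [set i]) (b (J :\ i)).
Proof.
move=> ha; rewrite /wedge.
rewrite (bigID (fun I => #|I| == 1%N)) /= [X in _ + X]big1 ?addr0; last first.
  by move=> I /andP[_ I1]; rewrite (homog0 ha I1) moyal0l scaler0.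
exact: (sum_singletons J (fun I => ext_sign R I (J :\: I) *: moyal (a I) (b (J :\: I)))).
Qed.

(** Summing over complements turns the one-form on the right into the one indexed
    by singletons, as in [wedge1E]. *)
Lemma wedgeE1 (a b : exterior R S) J : a \in homog 1 ->
  wedge b a J = \sum_(i in J) ext_sign R (J :\ i) [set i] *: moyal (b (J :\ i)) (a [set i]).
Proof.
move=> ha; rewrite /wedge.
have DD I : I \subset J -> J :\: (J :\: I) = I.
  by move=> IJ; rewrite setDDr finset.setDv finset.set0U; apply/setIidPr.
rewrite (reindex_onto (fun I => J :\: I) (fun I => J :\: I)) //=.
rewrite (eq_bigl (fun I => I \subset J)) => [|I]; last first.
  apply/andP/idP => [[_ /eqP <-]|IJ]; first exact: subsetDl.
  by rewrite subsetDl DD.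
rewrite (bigID (fun I => #|I| == 1%N)) /= [X in _ + X]big1 ?addr0; last first.
  by move=> I /andP[IJ I1]; rewrite DD // (homog0 ha I1) moyal0r scaler0.
pose G I := ext_sign R (J :\: I) I *: moyal (b (J :\: I)) (a I).
rewrite (eq_bigr G) => [|I /andP[IJ _]]; last by rewrite DD.
exact: sum_singletons.
Qed.

Lemma sum_set3 (V : zmodType) (G : 'I_4 -> V) x y z : x != y -> x != z -> y != z ->
  \sum_(i in [set x; y; z]) G i = G x + (G y + G z).
Proof.
move=> xy xz yz; rewrite -finset.setUA big_setU1 ?inE ?negb_or ?xy ?xz //.
by rewrite big_setU1 ?inE // big_set1.
Qed.

(** Moving dx^i past a two-form costs no sign, so the two wedge products combine
    into commutators of coefficients. *)
Lemma gcomm_triple (a b : exterior R S) x y z : a \in homog 1 ->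
  x != y -> x != z -> y != z ->
  let bracket i j k := moyal (a [set i]) (b [set j; k]) - moyal (b [set j; k]) (a [set i]) in
  gcomm 2 a b [set x; y; z] = (sgn x y * sgn x z) *: bracket x y z
    + ((sgn y x * sgn y z) *: bracket y x z + (sgn z x * sgn z y) *: bracket z x y).
Proof.
move=> ha xy xz yz bracket.
have -> : gcomm 2 a b [set x; y; z]
    = wedge a b [set x; y; z] - (-1) ^+ 2 *: wedge b a [set x; y; z] by [].
rewrite sqrrN expr1n scale1r wedge1E // wedgeE1 // -sumrB.
have pairs i j k : i != j -> i != k -> j != k -> [set i; j; k] = [set x; y; z] ->
  ext_sign R [set i] ([set x; y; z] :\ i) *:
    moyal (a [set i]) (b ([set x; y; z] :\ i)) -
  ext_sign R ([set x; y; z] :\ i) [set i] *: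
    moyal (b ([set x; y; z] :\ i)) (a [set i]) =
  (sgn i j * sgn i k) *: bracket i j k.
  move=> ij ik jk <-.
  have -> : [set i; j; k] :\ i = [set j; k].
    apply/setP => l; rewrite !inE; case: (l =P i) => // ->.
    by rewrite (negbTE ij) (negbTE ik).
  rewrite scalerBr !ext_signE !big_set1 !prod_set2 // !big_set1.
  (* ext_sign (jk) i = ext_sign i (jk): two sign changes *)
  by rewrite (@sgnC R i j) // (@sgnC R i k) // mulrNN.
rewrite sum_set3 // (pairs x y z) // (pairs y x z) // 1?eq_sym //; last first.
  by rewrite [[set y; x]]finset.setUC.
by rewrite (pairs z x y) // 1?eq_sym // -finset.setUA finset.setUC.
Qed.

Definition const_oneform e : exterior R S := fun J =>
  if [pick i | J == [set i]] is Some i then const_series (e i) else 0.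

Lemma const_oneform1 e i : const_oneform e [set i] = const_series (e i).
Proof.
rewrite /const_oneform; case: pickP => [j /eqP/finset.set1_inj -> //|/(_ i)].
by rewrite eqxx.
Qed.

Lemma const_oneform_homog e : const_oneform e \in homog 1.
Proof.
apply/asboolP => J J1; rewrite /const_oneform; case: pickP => // i /eqP Ji.
by case: J1; rewrite Ji cards1.
Qed.

Lemma const_oneformN e : - const_oneform e = const_oneform (fun i => - e i).
Proof.
apply/funext => J; apply/funext => m.
rewrite -[LHS]/(- const_oneform e J m) /const_oneform; case: pickP => [i _|_]; last first.
  exact: oppr0.
by rewrite /const_series; case: eqP; rewrite ?oppr0.
Qed.

(** The components of d (e_i dx^i) for ordered pairs of indices, antisymmetric in
    (x, y): this absorbs the sorting signs. *)
Definition curl e x y : smooth_fun R := pd x (e y) - pd y (e x).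

Lemma mpd_const_series x (f : smooth_fun R) :
  mpd x (const_series f) = const_series (pd x f).
Proof.
by apply/funext => m; rewrite /mpd /const_series; case: eqP; rewrite ?linear0.
Qed.

Lemma dext_const_oneform e x y : x != y ->
  dext (const_oneform e) [set x; y] = const_series (sgn x y *: curl e x y).
Proof.
move=> xy; rewrite dext_pair // !const_oneform1 !mpd_const_series (sgnC R xy) scaleNr -scalerBr.
by rewrite linearZ /=; congr (_ *: _); rewrite /curl linearB.
Qed.

Definition poisson (p : param S) (f g : smooth_fun R) :=
  pd (val p).1 f * pd (val p).2 g - pd (val p).2 f * pd (val p).1 g.

(** The semiclassical limit of the Moyal product: its first-order term is i/2 times
    the Poisson bracket, which is antisymmetric and hence doubles in a commutator. *)
Lemma moyal_commutator_mon1 p (f g : smooth_fun R) :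
  (moyal (const_series f) (const_series g) - moyal (const_series g) (const_series f)) (mon1 p)
  = 'i%C *: poisson p f g.
Proof.
rewrite -[LHS]/(moyal _ _ _ - moyal _ _ _) !moyal_const !moyal_coef_mon1 // -scalerBr.
rewrite -/(poisson p f g).
have -> : pd (val p).1 g * pd (val p).2 f - pd (val p).2 g * pd (val p).1 f = - poisson p f g.
  by rewrite /poisson; ring.
by rewrite opprK scalerDr -scalerDl -splitr.
Qed.

Lemma poissonZr p c (f g : smooth_fun R) : poisson p f (c *: g) = c *: poisson p f g.
Proof. by rewrite /poisson !linearZ /= !smooth_scaleAr -scalerBr. Qed.

(** Once the components of the two-form are antisymmetric in their indices, the
    three sorting signs agree and the commutator is a cyclic sum of brackets. *)
Lemma gcomm_const_oneform p e g x y z : x != y -> x != z -> y != z ->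
  gcomm 2 (const_oneform e) (dext (const_oneform g)) [set x; y; z] (mon1 p) =
  (sgn x y * sgn x z * sgn y z * 'i%C) *:
   (poisson p (e x) (curl g y z) + poisson p (e y) (curl g z x) + poisson p (e z) (curl g x y)).
Proof.
move=> xy xz yz; rewrite gcomm_triple ?const_oneform_homog //= !const_oneform1.
rewrite !dext_const_oneform //.
have addE (f h : moyal_alg R S) : (f + h) (mon1 p) = f (mon1 p) + h (mon1 p) by [].
have scaleE c (f : moyal_alg R S) : (c *: f) (mon1 p) = c *: f (mon1 p) by [].
have -> : curl g x z = -1 *: curl g z x by rewrite scaleN1r /curl opprB.
rewrite !addE !scaleE !moyal_commutator_mon1 !poissonZr.
move: (poisson p (e x) _) (poisson p (e y) _) (poisson p (e z) _) => P Q T.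
rewrite !scalerA !scalerDr -addrA (sgnC R xy) (sgnC R xz) (sgnC R yz).
have -> : - sgn x y * sgn y z * 'i%C * (sgn x z * -1) = sgn x y * sgn x z * 'i%C * sgn y z.
  by ring.
have -> : - sgn x z * - sgn y z * 'i%C * sgn x y = sgn x y * sgn x z * 'i%C * sgn y z.
  by ring.
by rewrite mulrAC.
Qed.

(** * Oriented frames and anti-self-dual curls *)

(** The sign of the permutation (x, y, z, w) of the four coordinates. *)
Definition orient x y z w : K :=
  sgn x y * sgn x z * sgn x w * sgn y z * sgn y w * sgn z w.

Lemma sgn_sq x y : sgn x y * sgn x y = 1.
Proof. by rewrite -expr2 sqrr_sign. Qed.

(** In a positively oriented frame the star exchanges the sorted components of
    complementary planes: the four mixed signs are what the orientation leaves
    besides sgn x y and sgn z w. *)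
Lemma star_oriented (a : exterior R S) x y z w : distinct4 x y z w -> orient x y z w = 1 ->
  star a [set x; y] = (sgn x y * sgn z w) *: mconj (a [set z; w]).
Proof.
move=> xyzw o; rewrite (star_pair _ _ _ (setC_pair xyzw)); last 2 first.
- by case/andP: xyzw.
- by case/and5P: xyzw => _ _ _ _ /andP[].
congr (_ *: _); case/and5P: xyzw => xy xz xw yz /andP[yw zw].
rewrite (sgnC R xz) (sgnC R yz) (sgnC R xw) (sgnC R yw) -[RHS]mulr1 -o /orient.
transitivity (sgn x y * sgn x y * (sgn z w * sgn z w) *
  (sgn x z * sgn y z * (sgn x w * sgn y w))); last by ring.
by rewrite !sgn_sq; ring.
Qed.

Lemma orient_swap34 x y z w : z != w -> orient x y w z = - orient x y z w.
Proof. by move=> zw; rewrite /orient (sgnC R zw); ring. Qed.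

Lemma orient_cycle234 x y z w : y != z -> y != w -> orient x z w y = orient x y z w.
Proof. by move=> yz yw; rewrite /orient (sgnC R yz) (sgnC R yw); ring. Qed.

Lemma orient_swap_pairs x y z w : distinct4 x y z w -> orient z w x y = orient x y z w.
Proof.
case/and5P=> xy xz xw yz /andP[yw zw].
by rewrite /orient (sgnC R xz) (sgnC R yz) (sgnC R xw) (sgnC R yw); ring.
Qed.

Lemma orient_sign x y z w : orient x y z w = 1 \/ orient x y z w = -1.
Proof.
suff /eqP : orient x y z w ^+ 2 = 1.
  by rewrite sqrf_eq1 => /orP[] /eqP ->; [left|right].
by rewrite /orient !exprMn !sqrr_sign !mulr1.
Qed.

(** Exchanging the two complementary indices changes the orientation, so one of
    the two orders is positive. *)
Lemma oriented_completion x y : x != y ->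
  exists z w, distinct4 x y z w /\ orient x y z w = 1.
Proof.
move=> xy.
have /eqP/cards2P[z [w [zw E]]] : #|~: [set x; y]| = 2.
  by rewrite cardsCs finset.setCK card_ord cards2 xy.
have d : distinct4 x y z w.
  have: z \in ~: [set x; y] by rewrite E !inE eqxx.
  have: w \in ~: [set x; y] by rewrite E !inE eqxx orbT.
  by rewrite /distinct4 !inE !negb_or !(eq_sym x) !(eq_sym y) eq_sym xy zw
    => /andP[-> ->] /andP[-> ->].
have [o|o] := orient_sign x y z w; first by exists z, w.
exists w, z; rewrite orient_swap34 // o opprK; split=> //.
by move: d; rewrite /distinct4 (eq_sym w) => /and5P[-> -> -> -> /andP[-> ->]].
Qed.

Lemma mconjD (f h : moyal_alg R S) : mconj (f + h) = mconj f + mconj h.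
Proof. by apply/funext => m; exact: sconjD. Qed.

Lemma mconj_dext (a : exterior R S) J : mconj (dext a J) = dext (fun I => mconj (a I)) J.
Proof.
rewrite /dext (big_morph _ mconjD (mconj0 R S)); apply: eq_bigr => mu _.
by rewrite mconj_signZ; congr (_ *: _); apply/funext => m; exact: sconj_pd.
Qed.

Lemma mconj_const_oneform e : (forall i, sconj (e i) = e i) ->
  forall I, mconj (const_oneform e I) = const_oneform e I.
Proof.
move=> er I; rewrite /const_oneform; case: pickP => [i _|_]; last exact: mconj0.
apply/funext => m; rewrite /mconj /const_series; case: eqP => // _.
exact: (congr1 (fun f : moyal_alg R S => f m) (mconj0 R S)).
Qed.

Lemma mconj_dext_const_oneform e : (forall i, sconj (e i) = e i) ->
  forall J, mconj (dext (const_oneform e) J) = dext (const_oneform e) J.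
Proof.
move=> er J; rewrite mconj_dext; congr (dext _ _).
by apply/funext; exact: mconj_const_oneform.
Qed.

(** The splittings xy|zw, xz|wy, xw|yz of a positive frame are again positive, and
    each equation between curls gives anti-self-duality on both planes of its
    splitting, the components being real. *)
Lemma curl_asd e x y z w : distinct4 x y z w -> orient x y z w = 1 ->
  (forall i, sconj (e i) = e i) ->
  curl e x y = - curl e z w -> curl e x z = - curl e w y -> curl e x w = - curl e y z ->
  star (dext (const_oneform e)) = - dext (const_oneform e).
Proof.
move=> d o er.
have Fr := mconj_dext_const_oneform er.
have half i j k l : distinct4 i j k l -> orient i j k l = 1 -> curl e i j = - curl e k l ->
    star (dext (const_oneform e)) [set i; j] = - dext (const_oneform e) [set i; j].
  move=> d' o' E; rewrite (star_oriented _ d' o') Fr.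
  case/and5P: d' => ij _ _ _ /andP[_ kl].
  rewrite !dext_const_oneform // -linearZ -linearN E; congr const_series.
  by rewrite scalerA -mulrA sgn_sq mulr1 scalerN opprK.
have both i j k l : distinct4 i j k l -> orient i j k l = 1 -> curl e i j = - curl e k l ->
    star (dext (const_oneform e)) [set i; j] = - dext (const_oneform e) [set i; j] /\
    star (dext (const_oneform e)) [set k; l] = - dext (const_oneform e) [set k; l].
  move=> d' o' E; split; first exact: half o' E.
  apply: (half k l i j); last by rewrite E opprK.
    by move: d'; rewrite /distinct4 !(eq_sym k) !(eq_sym l) => /and5P[-> -> -> -> /andP[-> ->]].
  by rewrite orient_swap_pairs.
case/and5P: (d) => xy xz xw yz /andP[yw zw] Exy Exz Exw.
have d2 : distinct4 x z w y.
  by rewrite /distinct4 xz xw xy zw (eq_sym z) yz (eq_sym w) yw.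
have d3 : distinct4 x w y z.
  by rewrite /distinct4 xz xw xy (eq_sym w) yw (eq_sym w) zw yz.
have o2 : orient x z w y = 1 by rewrite orient_cycle234.
have o3 : orient x w y z = 1 by rewrite orient_cycle234 // eq_sym.
have [Hxy Hzw] := both _ _ _ _ d o Exy.
have [Hxz Hwy] := both _ _ _ _ d2 o2 Exz.
have [Hxw Hyz] := both _ _ _ _ d3 o3 Exw.
have F2 : dext (const_oneform e) \in homog 2 by apply: dext_homog; exact: const_oneform_homog.
apply: homog2_eq => [||J J2]; rewrite ?rpredN ?star_homog2 //.
apply: (@pair_ind4 x y z w (fun J =>
  star (dext (const_oneform e)) J = (- dext (const_oneform e)) J)) J2 => //.
by rewrite finset.setUC.
Qed.

End ConstantOneForms.

(** * Field strengths and instantons *)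

Section FieldStrength.
Variables (R : realType) (S : {set 'I_4 * 'I_4}) (q : R).
Hypotheses (q0 : q != 0) (q1 : q != 1) (qN1 : q != -1).
Implicit Types (A : gauge_potential S q).

Lemma ord2_neq1 (a : 'I_2) : a != 1 -> a = 0.
Proof. by case: a => [[|[|//]]] ha //= _; apply/val_inj. Qed.

Lemma potential_homog A x : Omega_val (A x) \in homog 1.
Proof. exact: (valP (A x)). Qed.

Lemma field_strength_homog A x : field_strength A x \in homog 2.
Proof.
rewrite rpredB ?(dext_homog (potential_homog A x)) // rpred_sum // => a _.
rewrite rpred_sum // => b _; apply: rpredZ.
exact: (wedge_homog (potential_homog _ _) (potential_homog _ _)).
Qed.

Lemma field_strength_is_linear A : linear (field_strength A).
Proof.
move=> c x y; rewrite /field_strength.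
have -> : Omega_val (A (c *: x + y)) = c *: Omega_val (A x) + Omega_val (A y).
  by rewrite linearP.
rewrite linearP scalerBr [RHS]addrACA -opprD; congr (_ - _).
have ThetaP : Theta (c *: x + y) = c *: Theta x + Theta y.
  by rewrite /Theta !linearP /= [X in _ = X + _]scalerA -[RHS]scalerDl; congr (_ *: _); ring.
rewrite scaler_sumr -big_split; apply: eq_bigr => a _ /=.
rewrite scaler_sumr -big_split; apply: eq_bigr => b _ /=.
by rewrite ThetaP; move: (Theta x) (Theta y) => Tx Ty; rewrite !mxE scalerDl -scalerA.
Qed.
HB.instance Definition _ A := GRing.isLinear.Build R[i] (inv_Gamma q) (exterior R S) *:%R
  (field_strength A) (field_strength_is_linear A).

Lemma field_strength_basis A x : field_strength A x =
  linext (fun a => field_strength A (vtheta q a)) x.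
Proof.
rewrite {1}(inv_GammaE q0 q1 qN1 x) linear_sum.
by apply: eq_bigr => a _; rewrite linearZ.
Qed.

Lemma linext_vtheta (v : 'I_2 -> exterior R S) a : linext v (vtheta q a) = v a.
Proof.
rewrite /linext (bigD1 a) //= coord_vtheta // eqxx scale1r big1 ?addr0 // => b ba.
by rewrite coord_vtheta // (negbTE ba) scale0r.
Qed.

(** Both sides are linear in the argument: the field strength by
    [field_strength_is_linear], and the left one by the definition of the star of
    a linear map. *)
Lemma instanton_basis A : instanton A <->
  forall a, star (field_strength A (vtheta q a)) = - field_strength A (vtheta q a).
Proof.
split=> [AI a|AI x]; first by rewrite -AI /star_map linext_vtheta.
rewrite field_strength_basis /star_map /linext -sumrN.
by apply: eq_bigr => a _; rewrite AI scalerN.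
Qed.

End FieldStrength.

(** * A Cauchy-Riemann one-form *)

Section Example.
Variables (R : realType) (S : {set 'I_4 * 'I_4}).
Implicit Types (a b c d i : 'I_4).

(** The components of u dx^c + v dx^d with u + i v = (x^a + i x^b)^2. A quadratic
    potential is needed: a linear one has constant curl, which is central. *)
Definition cr_oneform a b c d i : smooth_fun R :=
  if i == c then coordX R a * coordX R a - coordX R b * coordX R b
  else if i == d then (coordX R a * coordX R b) *+ 2 else 0.

Lemma sconj_cr_oneform a b c d i : sconj (cr_oneform a b c d i) = cr_oneform a b c d i.
Proof.
rewrite /cr_oneform; case: eqP => _.
  by rewrite sconjD sconjN !sconjM !sconj_coordX.
case: eqP => _; first by rewrite mulr2n sconjD sconjM !sconj_coordX.
by apply: smooth_funP => x; exact: (rmorph0 (@conjc R)).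
Qed.

Variables a b c d : 'I_4.
Hypothesis abcd : distinct4 a b c d.
Notation e := (cr_oneform a b c d).
Notation xa := (coordX R a).
Notation xb := (coordX R b).
Notation E := (@const_oneform R S e).

Let ab : a != b. Proof. by case/and5P: abcd. Qed.
Let ac : a != c. Proof. by case/and5P: abcd. Qed.
Let ad : a != d. Proof. by case/and5P: abcd. Qed.
Let bc : b != c. Proof. by case/and5P: abcd. Qed.
Let bd : b != d. Proof. by case/and5P: abcd => _ _ _ _ /andP[]. Qed.
Let cd : c != d. Proof. by case/and5P: abcd => _ _ _ _ /andP[]. Qed.

Lemma cr_a : e a = 0. Proof. by rewrite /cr_oneform (negbTE ac) (negbTE ad). Qed.
Lemma cr_b : e b = 0. Proof. by rewrite /cr_oneform (negbTE bc) (negbTE bd). Qed.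

Lemma pd_cr_c i : pd i (e c) = ((i == a)%:R * xa - (i == b)%:R * xb) *+ 2.
Proof.
rewrite /cr_oneform eqxx linearB /= !pdM !pd_coordX; ring.
Qed.

Lemma pd_cr_d i : pd i (e d) = ((i == a)%:R * xb + (i == b)%:R * xa) *+ 2.
Proof.
rewrite /cr_oneform eq_sym (negbTE cd) eqxx linearMn /= pdM !pd_coordX; ring.
Qed.

Lemma curl_cr_ab : curl e a b = 0.
Proof. by rewrite /curl cr_a cr_b !pd0 subr0. Qed.

Lemma curl_cr_cd : curl e c d = 0.
Proof.
rewrite /curl pd_cr_c pd_cr_d !(eq_sym c) !(eq_sym d).
rewrite (negbTE ac) (negbTE ad) (negbTE bc) (negbTE bd) /=; ring.
Qed.

Lemma curl_cr_ac : curl e a c = xa *+ 2.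
Proof. rewrite /curl pd_cr_c cr_a pd0 eqxx (negbTE ab) /=; ring. Qed.

Lemma curl_cr_bc : curl e b c = - (xb *+ 2).
Proof. rewrite /curl pd_cr_c cr_b pd0 eqxx eq_sym (negbTE ab) /=; ring. Qed.

Lemma curl_cr_da : curl e d a = - (xb *+ 2).
Proof. rewrite /curl pd_cr_d cr_a pd0 eqxx (negbTE ab) /=; ring. Qed.

Lemma curl_cr_db : curl e d b = - (xa *+ 2).
Proof. rewrite /curl pd_cr_d cr_b pd0 eqxx eq_sym (negbTE ab) /=; ring. Qed.

Lemma curlN (g : 'I_4 -> smooth_fun R) i j : curl (fun k => - g k) i j = - curl g i j.
Proof. by rewrite /curl !linearN opprB opprK addrC. Qed.

(** The splitting ac|db is the equation pd a u = pd b v, the splitting ad|bc is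
    pd a v = - pd b u, and both curls of ab|cd vanish. *)
Lemma cr_oneform_asd : orient R a b c d = 1 ->
  star (dext E) = - dext E.
Proof.
move=> o; apply: (curl_asd S abcd o); first exact: sconj_cr_oneform.
- by rewrite curl_cr_ab curl_cr_cd oppr0.
- by rewrite curl_cr_ac curl_cr_db opprK.
- by rewrite curl_cr_bc opprK /curl -opprB -/(curl e d a) curl_cr_da opprK.
Qed.

(** The two brackets left in the component dx^a dx^c dx^d are {u, 2 x^b} and
    {v, - 2 x^a}, both equal to 4 x^a. *)
Lemma cr_oneform_gcomm : (forall p, p \in S -> (p.1 < p.2)%N) -> (a, b) \in S ->
  gcomm 2 E (- dext E) <> 0.
Proof.
move=> S_lt Sab; pose p : param S := Sub (a, b) Sab.
rewrite -[X in gcomm _ _ X]linearN const_oneformN.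
move=> /(congr1 (fun f : exterior R S => f [set a; c; d] (mon1 p))).
rewrite gcomm_const_oneform // !curlN curl_cr_cd curl_cr_da curl_cr_ac.
have -> : poisson p (e a) (- 0) + poisson p (e c) (- - (xb *+ 2)) + poisson p (e d) (- (xa *+ 2))
    = xa *+ 8.
  rewrite /poisson /= cr_a !pd_cr_c !pd_cr_d !linearN !linearMn /= !pd_coordX !pd0.
  by rewrite !eqxx (eq_sym b) (negbTE ab) /=; ring.
move/eqP; rewrite -[_ *+ 8](@scaler_nat R[i]) -[eqbRHS]/(0 : smooth_fun R) scaler_eq0.
case/orP; last by rewrite scaler_eq0 pnatr_eq0 (negbTE (coordX_neq0 R a)).
by rewrite !mulf_eq0 !signr_eq0 eq_complex /= oner_eq0 andbF.
Qed.

End Example.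

(** * Potentials without magnetic component *)

Section ElectricPotential.
Variables (R : realType) (S : {set 'I_4 * 'I_4}) (q : R).
Hypotheses (q0 : q != 0) (q1 : q != 1) (qN1 : q != -1).
Variable E : Omega R S 1.

Lemma electric_is_linear : linear (fun x : inv_Gamma q => Defs.coord 0 x *: E).
Proof. by move=> c x y; rewrite linearP /= scalerDl scalerA. Qed.
Definition electric_potential : gauge_potential S q :=
  HB.pack (fun x : inv_Gamma q => Defs.coord 0 x *: E)
  (GRing.isLinear.Build _ _ _ _ (fun x : inv_Gamma q => Defs.coord 0 x *: E) electric_is_linear).

Lemma electric_potential_e : electric_potential (vtheta q 0) = E.
Proof. by rewrite /= coord_vtheta // scale1r. Qed.

Lemma electric_potential_m : electric_potential (vtheta q 1) = 0.
Proof. by rewrite /= coord_vtheta // scale0r. Qed.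

(** Theta has no diagonal part, so each quadratic term pairs the electric component
    with the magnetic one, which is 0. *)
Lemma field_strength_electric a :
  field_strength electric_potential (vtheta q a) = dext (electric_potential (vtheta q a)).
Proof.
rewrite /field_strength big1 ?subr0 // => b _; apply: big1 => b' _.
have [b0|b1] := eqVneq b 1; first by rewrite b0 electric_potential_m wedge0l scaler0.
have [b0'|b1'] := eqVneq b' 1; first by rewrite b0' electric_potential_m wedge0r scaler0.
by rewrite (ord2_neq1 b1) (ord2_neq1 b1') /Theta !mxE /= addr0 mulr0 mulr0 scale0r.
Qed.

Lemma field_strength_electric_e : field_strength electric_potential (vtheta q 0) = dext E.
Proof. by rewrite field_strength_electric electric_potential_e. Qed.

Lemma field_strength_electric_m : field_strength electric_potential (vtheta q 1) = 0.
Proof. by rewrite field_strength_electric electric_potential_m linear0. Qed.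

Lemma electric_instanton : star (dext E) = - dext E -> instanton electric_potential.
Proof.
move=> asd; apply/(instanton_basis q0 q1 qN1) => a.
have [->|a1] := eqVneq a 1.
  rewrite field_strength_electric_m oppr0; apply/funext => J.
  by rewrite /star mconj0 scaler0.
by rewrite (ord2_neq1 a1) field_strength_electric_e.
Qed.

(** At vartheta^m the codifferential acts on F^m = 0, while the adjoint term uses
    the opposite component A (vartheta^e) = E and the sum F^e + F^m = dE. *)
Lemma electric_YM : star (dext E) = - dext E -> YM_solution electric_potential ->
  gcomm 2 E (- dext E) = 0.
Proof.
move=> asd [_]; rewrite /YM_operator field_strength_electric_m.
have star0 : star 0 = 0 :> exterior R S by apply/funext => J; rewrite /star mconj0 scaler0.
have starinv0 : starinv 0 = 0 :> exterior R S by rewrite -{1}star0 starK.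
rewrite /codiff star0 linear0 starinv0 scaler0 sub0r => /eqP; rewrite oppr_eq0 /dS_adj.
rewrite (linext_vtheta q0 q1 qN1) field_strength_electric_m field_strength_electric_e addr0 asd.
have -> : rev_ord 1 = 0 :> 'I_2 by apply/val_inj.
rewrite electric_potential_e scaler_eq0 => /orP[|/eqP /(congr1 (@star R S))].
  by rewrite expr1 mulN1r oppr_eq0 eq_complex /= oner_eq0 andbF.
by rewrite starinvK star0.
Qed.

End ElectricPotential.

(** * Instantons that do not solve the Yang-Mills equation *)

Theorem proposition4p2 (R : realType) (S : {set 'I_4 * 'I_4}) (q : R)
  (S_lt : forall p : 'I_4 * 'I_4, p \in S -> (p.1 < p.2)%N)
  (theta_neq0 : (0 < #|S|)%N)
  (q_neq0 : q != 0) (q_neq1 : q != 1) (q_neqN1 : q != -1) :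
  [/\ (* instantons can be tested on the basis (vartheta^e, vartheta^m) *)
      forall A : gauge_potential S q,
        instanton A <->
        star (field_strength A (vtheta q 0)) = - field_strength A (vtheta q 0) /\
        star (field_strength A (vtheta q 1)) = - field_strength A (vtheta q 1),
      (* the same in terms of the fields, star being antilinear *)
      forall A : gauge_potential S q,
        instanton A <->
        (forall j, mconj (De A j) = He A j) /\ (forall j, Dm A j = mconj (Hm A j)),
      (* for a real field strength this is D = H *)
      forall A : gauge_potential S q,
        (forall a I, mconj (field_strength A (vtheta q a) I)
                     = field_strength A (vtheta q a) I) ->
        (instanton A <-> De A = He A /\ Dm A = Hm A)
    & exists A : gauge_potential S q,
        [/\ instanton A, De A = He A, Dm A = Hm A & ~ YM_solution A]].
Proof.
have basisP (A : gauge_potential S q) : instanton A <->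
    star (field_strength A (vtheta q 0)) = - field_strength A (vtheta q 0) /\
    star (field_strength A (vtheta q 1)) = - field_strength A (vtheta q 1).
  rewrite (instanton_basis q_neq0 q_neq1 q_neqN1); split=> [AI //|[A0 A1] a].
  have [->//|a1] := eqVneq a 1.
  by rewrite (ord2_neq1 a1).
have fieldsP (A : gauge_potential S q) : instanton A <->
    (forall j, mconj (De A j) = He A j) /\ (forall j, Dm A j = mconj (Hm A j)).
  have asdP x := star_asd_fields (field_strength_homog A x).
  split=> [/basisP[/asdP H0 /asdP H1]|[H0 H1]].
    by split; [exact: H0|move=> j; exact: esym (H1 j)].
  by apply/basisP; split; apply/asdP; [exact: H0|move=> j; exact: esym (H1 j)].
have realP (A : gauge_potential S q) :
    (forall a I, mconj (field_strength A (vtheta q a) I) = field_strength A (vtheta q a) I) ->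
    (instanton A <-> De A = He A /\ Dm A = Hm A).
  move=> Ar; rewrite fieldsP.
  have eE j : mconj (De A j) = De A j by exact: Ar.
  have mE j : mconj (Hm A j) = Hm A j by exact: Ar.
  split=> [[He0 Hm0]|[He0 Hm0]]; split; try (apply/funext => j); try (move=> j).
  - by rewrite -He0 eE.
  - by rewrite Hm0 mE.
  - by rewrite eE He0.
  - by rewrite mE Hm0.
split=> //.
have /card_gt0P[[a b] Sab] := theta_neq0.
have ab : a != b by have := S_lt _ Sab; rewrite /= -val_eqE neq_ltn => ->.
(* complete the plane of a nonzero theta^{ab} to a positive frame *)
have [c [d [abcd o]]] := oriented_completion R ab.
pose e : 'I_4 -> smooth_fun R := cr_oneform R a b c d.
pose E : Omega R S 1 := MkOmega (const_oneform_homog S e).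
have asd : star (dext E) = - dext E by exact: cr_oneform_asd.
have AI : instanton (electric_potential q E) by exact: electric_instanton.
have Fr k I : mconj (field_strength (electric_potential q E) (vtheta q k) I)
    = field_strength (electric_potential q E) (vtheta q k) I.
  have [->|k1] := eqVneq k 1.
    by rewrite field_strength_electric_m //; exact: mconj0.
  rewrite (ord2_neq1 k1) field_strength_electric_e //.
  by apply: mconj_dext_const_oneform; exact: sconj_cr_oneform.
have [DHe DHm] := (realP _ Fr).1 AI.
exists (electric_potential q E); split=> // YM.
by apply: (cr_oneform_gcomm abcd S_lt Sab); exact: electric_YM YM.
Qed.
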